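(* For every infinite cardinal $\kappa\le\mathfrak{c}$ there exist $2^\kappa$ pairwise non-homeomorphic topologies $\tau\in\mathcal{L}$ such that $(\mathbb{R},\tau)$ is a completely normal space of first category of weight $\kappa$.
   Context: $\mathfrak{c}=|\mathbb{R}|$. $\eta$ denotes the Euclidean topology on $\mathbb{R}$. $\mathcal{L}$ denotes the family of all Hausdorff topologies $\tau$ on $\mathbb{R}$ with $\tau\subset\eta$. The weight of a space is the least cardinality of a base of its topology. *)

(* Defs.v *)
From Stdlib Require Import Reals.
Open Scope R_scope.

Definition subsetR (A B : R -> Prop) : Prop := forall x, A x -> B x.

Definition is_topology (tau : (R -> Prop) -> Prop) : Prop :=
  tau (fun _ => True) /\ tau (fun _ => False) /\
  (forall F : (R -> Prop) -> Prop, (forall U, F U -> tau U) ->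
     tau (fun x => exists U, F U /\ U x)) /\
  (forall U V, tau U -> tau V -> tau (fun x => U x /\ V x)).

Definition coarser_than_euclid (tau : (R -> Prop) -> Prop) : Prop :=
  forall U, tau U -> open_set U.

Definition hausdorff (tau : (R -> Prop) -> Prop) : Prop :=
  forall x y, x <> y -> exists U V, tau U /\ tau V /\ U x /\ V y /\
    (forall z, U z -> V z -> False).

Definition in_L (tau : (R -> Prop) -> Prop) : Prop :=
  is_topology tau /\ hausdorff tau /\ coarser_than_euclid tau.

Definition closed_in_sub (tau : (R -> Prop) -> Prop) (Y A : R -> Prop) : Prop :=
  subsetR A Y /\ exists U, tau U /\ forall x, Y x -> (A x <-> ~ U x).

Definition subspace_normal (tau : (R -> Prop) -> Prop) (Y : R -> Prop) : Prop :=
  (forall y, Y y -> closed_in_sub tau Y (fun x => x = y)) /\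
  (forall A B, closed_in_sub tau Y A -> closed_in_sub tau Y B ->
     (forall x, A x -> B x -> False) ->
     exists U V, tau U /\ tau V /\ subsetR A U /\ subsetR B V /\
       (forall x, Y x -> U x -> V x -> False)).

Definition completely_normal (tau : (R -> Prop) -> Prop) : Prop :=
  forall Y : R -> Prop, subspace_normal tau Y.

Definition closure (tau : (R -> Prop) -> Prop) (A : R -> Prop) : R -> Prop :=
  fun x => forall U, tau U -> U x -> exists y, U y /\ A y.

Definition nowhere_dense (tau : (R -> Prop) -> Prop) (A : R -> Prop) : Prop :=
  forall U, tau U -> subsetR U (closure tau A) -> forall x, ~ U x.

Definition first_category (tau : (R -> Prop) -> Prop) : Prop :=
  exists N : nat -> (R -> Prop), (forall n, nowhere_dense tau (N n)) /\
    forall x, exists n, N n x.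

Definition is_base (tau : (R -> Prop) -> Prop) (B : (R -> Prop) -> Prop) : Prop :=
  (forall b, B b -> tau b) /\
  (forall U x, tau U -> U x -> exists b, B b /\ b x /\ subsetR b U).

Definition weight_eq (tau : (R -> Prop) -> Prop) (K : Type) : Prop :=
  (exists f : K -> (R -> Prop),
      (forall i j, f i = f j -> i = j) /\
      is_base tau (fun b => exists k, f k = b)) /\
  (forall B, is_base tau B ->
      exists g : K -> {b : R -> Prop | B b},
        forall i j, g i = g j -> i = j).

Definition homeomorphic (tau1 tau2 : (R -> Prop) -> Prop) : Prop :=
  exists h g : R -> R,
    (forall x, g (h x) = x) /\ (forall y, h (g y) = y) /\
    (forall U, tau2 U -> tau1 (fun x => U (h x))) /\
    (forall U, tau1 U -> tau2 (fun y => U (g y))).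

(* Main.v *)
(** Every topology used is the initial topology of a family of continuous piecewise linear
    functions, hence regular and, being coarser than the Euclidean line, hereditarily
    Lindelöf; so it is completely normal.  The value of such a function at an integer m far
    from the origin is its value at an earlier point [target m].  Hence a point that is
    approximated by [target m] for infinitely many m is a limit of integers going to
    infinity.  Letting [target] be dense along the positive integers makes every nonempty
    open set unbounded above, which gives first category, while the points all of whose
    neighbourhoods are unbounded below are exactly the marks 0, -4, -8, ...

    To encode s : K -> bool, take an independent family of subsets A_k of nat.  A function
    vanishing at 0 and, among the marks -4n, exactly at those with (n in A_k <-> s k) forces the
    neighbourhoods of 0 to trace on the marks the filter generated by these conditions.  The
    filter has character |K|, which gives the weight, and it determines s.

    By Sierpinski's theorem on countable decompositions of an interval into closed sets, a
    homeomorphism between two of these topologies is continuous for the Euclidean topology,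
    hence monotone.  It preserves the set of marks, so it is increasing and fixes each mark;
    therefore it carries one filter to the other. *)
Require Import Defs.
From Stdlib Require Import Reals Lra Lia ZArith List Cantor.
From Stdlib Require Import Classical ClassicalEpsilon IndefiniteDescription.
From mathcomp Require boolp classical_sets.

(** * Cardinal arithmetic *)

Definition embeds (A B : Type) : Prop :=
  exists f : A -> B, forall x y, f x = f y -> x = y.

Lemma embeds_trans A B C : embeds A B -> embeds B C -> embeds A C.
Proof.
  intros [f Hf] [g Hg]; exists (fun x => g (f x)); auto.
Qed.

Lemma embeds_prod A A' B B' : embeds A A' -> embeds B B' -> embeds (A * B) (A' * B').
Proof.
  intros [f Hf] [g Hg]; exists (fun p => (f (fst p), g (snd p))).
  intros [a b] [a' b'] H; simpl in H; injection H; intros; f_equal; auto.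
Qed.

Definition chain {T} (F : (T -> Prop) -> Prop) : Prop :=
  forall X Y, F X -> F Y -> (forall t, X t -> Y t) \/ (forall t, Y t -> X t).

Lemma Zorn_union {T} (P : (T -> Prop) -> Prop) :
  (forall F, (forall X, F X -> P X) -> chain F -> P (fun t => exists X, F X /\ X t)) ->
  exists M, P M /\ forall N, P N -> (forall t, M t -> N t) -> forall t, N t -> M t.
Proof.
  intros H.
  destruct (@classical_sets.Zorn_bigcup T P) as [M [PM maxM]].
  - intros F FP Ft.
    assert (E : classical_sets.bigcup F (fun X => X) = (fun t => exists X, F X /\ X t)).
    { apply boolp.funext; intros t; apply boolp.propext; split.
      - intros [X FX Xt]; exists X; split; assumption.
      - intros [X [FX Xt]]; exists X; assumption. }
    rewrite E; apply H; [exact FP|exact Ft].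
  - exists M; split; [exact PM|].
    intros N PN MN; apply NNPP; intros C; apply (maxM N); [|exact PN].
    split; [exact MN|exact C].
Qed.

Definition subset_embeds {T} (A B : T -> Prop) : Prop :=
  exists g : T -> T, (forall x, A x -> B (g x)) /\
    forall x y, A x -> A y -> g x = g y -> x = y.

Lemma subset_embeds_total {T} (A B : T -> Prop) : subset_embeds A B \/ subset_embeds B A.
Proof.
  (* Graphs of partial injections from A to B. A maximal one is total on A or onto B, since
     otherwise a pair of missed points could be added. *)
  pose (P := fun G : T * T -> Prop =>
    (forall x y, G (x, y) -> A x /\ B y) /\
    (forall x y y', G (x, y) -> G (x, y') -> y = y') /\
    (forall x x' y, G (x, y) -> G (x', y) -> x = x')).
  destruct (Zorn_union P) as [M [[M1 [M2 M3]] Mmax]].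
  { intros F FP Fc. split; [|split].
    - intros x y [X [FX Xxy]]. apply (FP X FX), Xxy.
    - intros x y y' [X [FX H1]] [Y [FY H2]].
      destruct (Fc X Y FX FY) as [S|S]; apply S in H1 || apply S in H2.
      + destruct (FP Y FY) as [_ [U _]]; eapply U; eauto.
      + destruct (FP X FX) as [_ [U _]]; eapply U; eauto.
    - intros x x' y [X [FX H1]] [Y [FY H2]].
      destruct (Fc X Y FX FY) as [S|S]; apply S in H1 || apply S in H2.
      + destruct (FP Y FY) as [_ [_ U]]; eapply U; eauto.
      + destruct (FP X FX) as [_ [_ U]]; eapply U; eauto. }
  destruct (classic (forall x, A x -> exists y, M (x, y))) as [HA|HA].
  { left. destruct (functional_choice (fun x y => A x -> M (x, y))) as [g Hg].
    - intros x; destruct (classic (A x)) as [a|a].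
      + destruct (HA x a) as [y Hy]; exists y; auto.
      + exists x; tauto.
    - exists g; split.
      + intros x a; apply (M1 x (g x)); auto.
      + intros x y a b E; apply (M3 x y (g x)); [auto|rewrite E; auto]. }
  right. destruct (functional_choice (fun y x => B y -> M (x, y))) as [g Hg].
  - intros y; apply NNPP; intros C. apply HA; intros x a.
    apply NNPP; intros D.
    assert (By : B y) by (apply NNPP; intros N; apply C; exists y; tauto).
    apply D; exists y.
    apply (Mmax (fun p => M p \/ p = (x, y))); [|auto|auto].
    split; [|split].
    + intros x0 y0 [H|H]; [apply M1; auto|injection H; intros; subst; auto].
    + intros x0 y0 y1 [H|H] [H'|H']; try (injection H; intros); try (injection H'; intros); subst; eauto.
      * exfalso; apply D; eauto.
      * exfalso; apply D; eauto.
    + intros x0 x1 y0 [H|H] [H'|H']; try (injection H; intros); try (injection H'; intros); subst; eauto.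
      * exfalso; apply C; eauto.
      * exfalso; apply C; eauto.
  - exists g; split.
    + intros y b; apply (M1 (g y) y); auto.
    + intros x y a b E; apply (M2 (g x)); [auto|rewrite E; auto].
Qed.

(** Zorn's lemma gives a maximal injection D * D -> D extending the pairing on a copy of nat. If D
    embeds in its complement, the injection extends to the union of D and a copy of D, a
    contradiction. Otherwise the complement embeds in D, so K itself injects into D. *)
Lemma embeds_square (K : Type) : embeds nat K -> embeds (K * K) K.
Proof.
  intros [e e_inj].
  pose (dom := fun (G : K * K * K -> Prop) x => exists y z, G (x, y, z)).
  pose (P := fun G : K * K * K -> Prop =>
    (forall x y z, G (x, y, z) -> dom G y /\ dom G z) /\
    (forall x y, dom G x -> dom G y -> exists z, G (x, y, z)) /\
    (forall x y z z', G (x, y, z) -> G (x, y, z') -> z = z') /\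
    (forall x y x' y' z, G (x, y, z) -> G (x', y', z) -> x = x' /\ y = y')).
  pose (G0 := fun p : K * K * K => exists a b, p = (e a, e b, e (to_nat (a, b)))).
  assert (dom0 : forall a, dom G0 (e a)) by (intros a; exists (e a), (e (to_nat (a, a))), a, a; reflexivity).
  assert (P0 : P G0).
  { split; [|split; [|split]].
    - intros x y z [a [b E]]; injection E; intros; subst; auto.
    - intros x y [? [? [a [? E]]]] [? [? [b [? E']]]].
      injection E; injection E'; intros; subst.
      exists (e (to_nat (a, b))), a, b; reflexivity.
    - intros x y z z' [a [b E]] [a' [b' E']]; injection E; injection E'; intros; subst.
      repeat match goal with H : e _ = e _ |- _ => apply e_inj in H end; subst.
      reflexivity.
    - intros x y x' y' z [a [b E]] [a' [b' E']].
      assert (Ez : e (to_nat (a, b)) = e (to_nat (a', b'))).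
      { apply (f_equal snd) in E, E'; cbn [snd] in E, E'; congruence. }
      apply e_inj, (f_equal of_nat) in Ez; rewrite !cancel_of_to in Ez.
      injection Ez; intros; subst; injection E; injection E'; intros; subst.
      auto. }
  assert (dom_mono : forall G G' : K * K * K -> Prop, (forall t, G t -> G' t) -> forall x, dom G x -> dom G' x)
    by (intros G G' S x [y [z H]]; exists y, z; auto).
  destruct (Zorn_union (fun G => (forall t, ~ G t) \/ (P G /\ forall t, G0 t -> G t))) as [M [HM Mmax]].
  { intros F FP Fc.
    destruct (classic (exists X t, F X /\ X t)) as [[X0 [t0 [FX0 X0t0]]]|N].
    2:{ left; intros t [X [FX Xt]]; apply N; eauto. }
    right.
    assert (FP' : forall X t, F X -> X t -> P X).
    { intros X t FX Xt; destruct (FP X FX) as [E|E]; [exfalso; eapply E; eauto|apply E]. }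
    assert (sub : forall X, F X -> forall x, dom X x -> dom (fun t => exists X, F X /\ X t) x)
      by (intros X FX; apply dom_mono; eauto).
    split.
    - split; [|split; [|split]].
      + intros x y z [X [FX H]]. destruct (FP' X _ FX H) as [U _].
        destruct (U _ _ _ H) as [D1 D2]; eauto.
      + intros x y [y1 [z1 [X [FX H1]]]] [y2 [z2 [Y [FY H2]]]].
        destruct (Fc X Y FX FY) as [S|S].
        * destruct (FP' Y _ FY H2) as [_ [U _]].
          destruct (U x y) as [z Hz]; [exists y1, z1; auto|exists y2, z2; auto|exists z, Y; auto].
        * destruct (FP' X _ FX H1) as [_ [U _]].
          destruct (U x y) as [z Hz]; [exists y1, z1; auto|exists y2, z2; auto|exists z, X; auto].
      + intros x y z z' [X [FX H1]] [Y [FY H2]].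
        destruct (Fc X Y FX FY) as [S|S].
        * destruct (FP' Y _ FY H2) as [_ [_ [U _]]]; eapply U; eauto.
        * destruct (FP' X _ FX H1) as [_ [_ [U _]]]; eapply U; eauto.
      + intros x y x' y' z [X [FX H1]] [Y [FY H2]].
        destruct (Fc X Y FX FY) as [S|S].
        * destruct (FP' Y _ FY H2) as [_ [_ [_ U]]]; eapply U; eauto.
        * destruct (FP' X _ FX H1) as [_ [_ [_ U]]]; eapply U; eauto.
    - intros t Ht; exists X0; split; [exact FX0|].
      destruct (FP X0 FX0) as [E|[_ E]]; [exfalso; eapply E; eauto|auto]. }
  destruct HM as [HM|[[M1 [M2 [M3 M4]]] HM0]].
  { exfalso. apply (HM (e 0%nat, e 0%nat, e (to_nat (0, 0))%nat)).
    apply (Mmax G0); [right; auto|intros t Ht; exfalso; eapply HM; eauto|].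
    exists 0%nat, 0%nat; reflexivity. }
  pose (D := dom M).
  assert (De : forall a, D (e a)) by (intros a; eapply dom_mono; [exact HM0|apply dom0]).
  destruct (functional_choice (fun (p : K * K) z => D (fst p) -> D (snd p) -> M (fst p, snd p, z))) as [m' Hm'].
  { intros [x y]; simpl. destruct (classic (D x /\ D y)) as [[d1 d2]|N].
    - destruct (M2 x y d1 d2) as [z Hz]; exists z; auto.
    - exists x; tauto. }
  pose (m := fun x y => m' (x, y)).
  assert (Hm : forall x y, D x -> D y -> M (x, y, m x y)) by (intros x y; apply (Hm' (x, y))).
  assert (Dm : forall x y, D x -> D y -> D (m x y)) by (intros x y a b; apply (M1 x y); auto).
  assert (m_inj : forall x y x' y', D x -> D y -> D x' -> D y' -> m x y = m x' y' -> x = x' /\ y = y').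
  { intros x y x' y' a b c d E; apply (M4 _ _ _ _ (m x y)); [auto|rewrite E; auto]. }
  destruct (subset_embeds_total D (fun x => ~ D x)) as [[g [g1 g2]]|[g [g1 g2]]].
  - exfalso.
    (* [i] enumerates D and its disjoint copy g(D). The pairs that involve the copy are new; [cd]
       sends them into the copy, and [tag] tells their three kinds apart. *)
    pose (i := fun (b : bool) d => if b then g d else d).
    pose (tag := fun b1 b2 : bool => if b1 then if b2 then 1%nat else 2%nat else 3%nat).
    pose (cd := fun b1 b2 d1 d2 => g (m (m (e (tag b1 b2)) d1) d2)).
    pose (new := fun p : K * K * K => exists b1 b2 d1 d2, D d1 /\ D d2 /\ orb b1 b2 = true /\
                  p = (i b1 d1, i b2 d2, cd b1 b2 d1 d2)).
    assert (i_inj : forall b d b' d', D d -> D d' -> i b d = i b' d' -> b = b' /\ d = d').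
    { intros [] d [] d' H1 H2 E; simpl in E; auto.
      - exfalso; apply (g1 d H1); rewrite E; auto.
      - exfalso; apply (g1 d' H2); rewrite <- E; auto. }
    assert (cd_inj : forall b1 b2 d1 d2 b1' b2' d1' d2', D d1 -> D d2 -> D d1' -> D d2' ->
      orb b1 b2 = true -> orb b1' b2' = true ->
      cd b1 b2 d1 d2 = cd b1' b2' d1' d2' -> b1 = b1' /\ b2 = b2' /\ d1 = d1' /\ d2 = d2').
    { intros b1 b2 d1 d2 b1' b2' d1' d2' H1 H2 H3 H4 O O' E. unfold cd in E.
      apply g2 in E; auto.
      apply m_inj in E; auto. destruct E as [E E2]. apply m_inj in E; auto.
      destruct E as [E E1]. apply e_inj in E.
      destruct b1, b2, b1', b2'; simpl in *; try discriminate; auto. }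
    assert (Dcd : forall b1 b2 d1 d2, D d1 -> D d2 -> ~ D (cd b1 b2 d1 d2)).
    { intros; apply g1; auto. }
    pose (N := fun t => M t \/ new t).
    assert (ND : forall x, dom N x <-> exists b d, D d /\ x = i b d).
    { intros x; split.
      - intros [y [z [H|[b1 [b2 [d1 [d2 [H1 [H2 [H3 H4]]]]]]]]]].
        + exists false, x; split; [exists y, z; auto|reflexivity].
        + injection H4; intros; subst; eauto.
      - intros [b [d [H ->]]].
        exists (i true d), (cd b true d d); right.
        exists b, true, d, d; repeat split; auto. destruct b; auto. }
    assert (PN : P N).
    { split; [|split; [|split]].
      - intros x y z [H|[b1 [b2 [d1 [d2 [H1 [H2 [H3 H4]]]]]]]].
        + destruct (M1 _ _ _ H). split; apply ND; [exists false, y|exists false, z]; auto.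
        + injection H4; intros; subst; split; apply ND; [eauto|].
          exists true, (m (m (e (tag b1 b2)) d1) d2); split; [auto|reflexivity].
      - intros x y Hx Hy. apply ND in Hx; apply ND in Hy.
        destruct Hx as [b1 [d1 [H1 ->]]], Hy as [b2 [d2 [H2 ->]]].
        destruct (orb b1 b2) eqn:O.
        + exists (cd b1 b2 d1 d2); right; exists b1, b2, d1, d2; auto.
        + destruct b1, b2; try discriminate. exists (m d1 d2); left; apply Hm; auto.
      - assert (old_new : forall x y z z', M (x, y, z) -> new (x, y, z') -> False).
        { intros x y z z' H [b1 [b2 [d1 [d2 [H1 [H2 [H3 H4]]]]]]].
          injection H4; intros; subst.
          assert (Dx : D (i b1 d1)) by (exists (i b2 d2), z; auto).
          assert (Dy : D (i b2 d2)) by (apply (M1 _ _ _ H)).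
          destruct b1; [apply (g1 d1); auto|]. destruct b2; [apply (g1 d2); auto|discriminate]. }
        intros x y z z' [H|H] [H'|H']; [eauto|exfalso; eauto|exfalso; eauto|].
        destruct H as [b1 [b2 [d1 [d2 [H1 [H2 [H3 H4]]]]]]].
        destruct H' as [b1' [b2' [d1' [d2' [H1' [H2' [H3' H4']]]]]]].
        injection H4; injection H4'; intros; subst.
        match goal with A : i _ _ = i _ _, B : i _ _ = i _ _ |- _ =>
          apply i_inj in A; auto; apply i_inj in B; auto; destruct A, B; subst end.
        reflexivity.
      - intros x y x' y' z [H|H] [H'|H'].
        + eauto.
        + destruct H' as [b1' [b2' [d1' [d2' [H1' [H2' [H3' H4']]]]]]].
          injection H4'; intros; subst. exfalso; apply (Dcd b1' b2' d1' d2'); auto.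
          apply (M1 _ _ _ H).
        + destruct H as [b1' [b2' [d1' [d2' [H1' [H2' [H3' H4']]]]]]].
          injection H4'; intros; subst. exfalso; apply (Dcd b1' b2' d1' d2'); auto.
          apply (M1 _ _ _ H').
        + destruct H as [b1 [b2 [d1 [d2 [H1 [H2 [H3 H4]]]]]]].
          destruct H' as [b1' [b2' [d1' [d2' [H1' [H2' [H3' H4']]]]]]].
          injection H4; injection H4'; intros; subst.
          match goal with A : cd _ _ _ _ = cd _ _ _ _ |- _ => apply cd_inj in A; auto;
            destruct A as [? [? [? ?]]]; subst end.
          auto. }
    assert (Dg : D (g (e 0%nat))).
    { assert (W : M (g (e 0%nat), g (e 0%nat), cd true true (e 0%nat) (e 0%nat))).
      { apply (Mmax N); [right; split; [exact PN|intros t Ht; left; auto]|intros t Ht; left; auto|].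
        right; exists true, true, (e 0%nat), (e 0%nat); auto. }
      exists (g (e 0%nat)), (cd true true (e 0%nat) (e 0%nat)); exact W. }
    apply (g1 (e 0%nat)); auto.
  (* The complement embeds in D by [g]; the factors [e 0] and [e 1] keep its image apart from that
     of D, so [u] injects K into D. *)
  - pose (u := fun x => if excluded_middle_informative (D x) then m (e 0%nat) x else m (e 1%nat) (g x)).
    assert (Du : forall x, D (u x)).
    { intros x; unfold u; destruct (excluded_middle_informative (D x)); auto. }
    assert (u_inj : forall x y, u x = u y -> x = y).
    { intros x y; unfold u.
      destruct (excluded_middle_informative (D x)), (excluded_middle_informative (D y)); intros E;
        apply m_inj in E; auto; destruct E as [E1 E2]; auto.
      all: apply e_inj in E1; discriminate. }
    exists (fun p => m (u (fst p)) (u (snd p))).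
    intros [x y] [x' y'] E; simpl in E. apply m_inj in E; auto. destruct E; f_equal; auto.
Qed.

Lemma embeds_list (K : Type) : embeds nat K -> embeds (list K) K.
Proof.
  intros Kinf. destruct (embeds_square K Kinf) as [p Hp]. destruct Kinf as [e He].
  exists (fix code l := match l with nil => p (e 0%nat, e 0%nat)
            | x :: l' => p (e 1%nat, p (x, code l')) end).
  intros l; induction l as [|x l IH]; intros [|y l'] E; auto; apply Hp in E;
    assert (E1 := f_equal fst E); assert (E2 := f_equal snd E); cbn [fst snd] in E1, E2.
  - apply He in E1; discriminate.
  - apply He in E1; discriminate.
  - apply Hp in E2. injection E2; intros; f_equal; auto.
Qed.

Lemma Cantor_Bernstein (A B : Type) : embeds A B -> embeds B A ->
  exists h : A -> B, (forall x y, h x = h y -> x = y) /\ forall b, exists a, h a = b.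
Proof.
  intros [f Hf] [g Hg].
  (* The points whose backward orbit stops outside the range of [g]. There [h] is [f], and elsewhere
     it is the inverse of [g]. *)
  pose (S := fun x => exists n y, (forall b, g b <> y) /\ x = Nat.iter n (fun a => g (f a)) y).
  pose (h := fun x => if excluded_middle_informative (S x) then f x
     else epsilon (inhabits (f x)) (fun b => g b = x)).
  assert (h1 : forall x, S x -> h x = f x).
  { intros x Hx; unfold h; destruct (excluded_middle_informative (S x)); tauto. }
  assert (h2 : forall x, ~ S x -> g (h x) = x).
  { intros x Hx; unfold h; destruct (excluded_middle_informative (S x)); [tauto|].
    apply (epsilon_spec (inhabits (f x)) (fun b => g b = x)).
    apply NNPP; intros N; apply Hx; exists 0%nat, x; split; [|reflexivity].
    intros b E; apply N; eauto. }
  assert (S1 : forall x, S x -> S (g (f x))).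
  { intros x [n [y [Hy ->]]]; exists (Datatypes.S n), y; split; auto. }
  exists h; split.
  - intros x y E. destruct (classic (S x)) as [sx|sx], (classic (S y)) as [sy|sy].
    + rewrite !h1 in E; auto.
    + exfalso; apply sy. rewrite <- (h2 y sy), <- E, h1; auto.
    + exfalso; apply sx. rewrite <- (h2 x sx), E, h1; auto.
    + rewrite <- (h2 x sx), <- (h2 y sy), E; reflexivity.
  - intros b. destruct (classic (S (g b))) as [s|s].
    + destruct s as [[|n] [y [Hy E]]].
      * exfalso; apply (Hy b); exact E.
      * exists (Nat.iter n (fun a => g (f a)) y). rewrite h1; [apply Hg; symmetry; exact E|].
        exists n, y; auto.
    + exists (g b). apply Hg, h2, s.
Qed.

(** Each index [acc k] is at least the bound [N] for every value taken earlier, so its own value is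
    new. *)
Lemma embeds_nat_of_finite_fibres (X : Type) (f : nat -> X) :
  (forall x, exists N, forall n, f n = x -> (n < N)%nat) -> embeds nat X.
Proof.
  intros H. destruct (functional_choice _ H) as [N HN].
  pose (acc := fix acc k := match k with O => 0%nat
    | S k' => Nat.max (acc k') (N (f (acc k'))) end).
  assert (mono : forall i k, (i <= k)%nat -> (acc i <= acc k)%nat).
  { intros i k L; induction L as [|k L IH]; [lia|]. change (acc (S k)) with (Nat.max (acc k) (N (f (acc k)))). lia. }
  assert (lt : forall i k, (i < k)%nat -> f (acc k) <> f (acc i)).
  { intros i k L E. apply HN in E.
    assert (L' := mono (S i) k L). change (acc (S i)) with (Nat.max (acc i) (N (f (acc i)))) in L'. lia. }
  exists (fun k => f (acc k)). intros i k E.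
  destruct (Nat.lt_trichotomy i k) as [L|[L|L]]; auto; exfalso.
  - apply (lt i k L); auto.
  - apply (lt k i L); auto.
Qed.


(** Pairing [f k] with the position of [k] in the list for its fibre embeds K in X * nat, and X is
    infinite because nat embeds in K. This serves to bound the size of a base from below. *)
Lemma embeds_of_finite_fibres (K X : Type) (f : K -> X) :
  embeds nat K -> (forall x, exists l, forall k, f k = x -> In k l) -> embeds K X.
Proof.
  intros [e He] H. destruct (functional_choice _ H) as [l Hl].
  assert (Xinf : embeds nat X).
  { apply (embeds_nat_of_finite_fibres X (fun n => f (e n))). intros x.
    assert (G : forall l : list K, exists N, forall n, In (e n) l -> (n < N)%nat).
    { induction l0 as [|k l0 [N IH]]; [exists 0%nat; simpl; tauto|].
      destruct (classic (exists n, e n = k)) as [[n0 E]|C].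
      - exists (Nat.max N (S n0)). intros n [I|I].
        + rewrite <- E in I; apply He in I; lia.
        + apply IH in I; lia.
      - exists N. intros n [I|I]; auto. exfalso; apply C; eauto. }
    destruct (G (l x)) as [N HN]; exists N; intros n E; apply HN, Hl, E. }
  destruct (functional_choice (fun k n => nth_error (l (f k)) n = Some k)) as [ix Hix].
  { intros k; apply In_nth_error, Hl; reflexivity. }
  apply embeds_trans with (X * X)%type; [|apply embeds_square, Xinf].
  apply embeds_trans with (X * nat)%type; [|apply embeds_prod; [exists (fun x => x); auto|auto]].
  exists (fun k => (f k, ix k)). intros x y E; injection E; intros E2 E1.
  assert (A := Hix x); rewrite E1, E2, Hix in A. injection A; auto.
Qed.

(** * Initial topologies coarser than the Euclidean one *)

Definition q (i : nat) : R :=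
  let (p, c) := of_nat i in let (a, b) := of_nat p in (INR a - INR b) / (INR c + 1).

(** The Cantor pairing dominates its components, and the denominator is at least 1. The bound lets
    the recursion for [node] refer only to points nearer the origin. *)
Lemma q_bound i : Rabs (q i) <= INR i.
Proof.
  unfold q. destruct (of_nat i) as [p c] eqn:E1, (of_nat p) as [a b] eqn:E2.
  assert (L1 := to_nat_non_decreasing p c). rewrite <- E1, cancel_to_of in L1.
  assert (L2 := to_nat_non_decreasing a b). rewrite <- E2, cancel_to_of in L2.
  assert (La : INR a + INR b <= INR i) by (rewrite <- plus_INR; apply le_INR; lia).
  assert (Pa := pos_INR a). assert (Pb := pos_INR b). assert (Pc := pos_INR c).
  assert (U : forall z, Rabs z <= INR i -> Rabs (z / (INR c + 1)) <= INR i).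
  { intros z Hz. unfold Rdiv. rewrite Rabs_mult, (Rabs_pos_eq (/ _)) by (left; apply Rinv_0_lt_compat; lra).
    apply Rmult_le_reg_r with (INR c + 1); [lra|].
    rewrite Rmult_assoc, Rinv_l, Rmult_1_r by lra. assert (0 <= Rabs z) by apply Rabs_pos. nra. }
  apply U, Rabs_le; lra.
Qed.

Lemma q_dense x y : x < y -> exists i, x < q i < y.
Proof.
  intros H. destruct (archimed_cor1 (y - x)) as [N [HN N0]]; [lra|].
  destruct N as [|c]; [lia|]. rewrite S_INR in HN.
  assert (Pc := pos_INR c).
  pose (z := up (x * (INR c + 1))).
  destruct (archimed (x * (INR c + 1))) as [z1 z2]; fold z in z1, z2.
  exists (to_nat (to_nat (Z.to_nat z, Z.to_nat (- z)), c)).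
  unfold q; rewrite !cancel_of_to.
  assert (E : INR (Z.to_nat z) - INR (Z.to_nat (- z)) = IZR z).
  { rewrite !INR_IZR_INZ, <- minus_IZR. f_equal. lia. }
  rewrite E.
  assert (I : / (INR c + 1) * (INR c + 1) = 1) by (apply Rinv_l; lra).
  assert (D : IZR z / (INR c + 1) * (INR c + 1) = IZR z) by (field; lra).
  split; apply Rmult_lt_reg_r with (INR c + 1); try lra; rewrite D; nra.
Qed.

Definition cont (f : R -> R) : Prop :=
  forall x eps, 0 < eps -> exists delta, 0 < delta /\
    forall y, Rabs (y - x) < delta -> Rabs (f y - f x) < eps.

Definition near {I} (F : I -> R -> R) (l : list I) (eps x y : R) : Prop :=
  forall i, In i l -> Rabs (F i y - F i x) < eps.

(** The initial topology of the family, with the sets [near F l eps x] as basic neighbourhoods. *)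
Definition topo {I} (F : I -> R -> R) (U : R -> Prop) : Prop :=
  forall x, U x -> exists l eps, 0 < eps /\ forall y, near F l eps x y -> U y.

Section InitialTopology.
Context {I : Type} (F : I -> R -> R).

Lemma near_refl l eps x : 0 < eps -> near F l eps x x.
Proof. intros H i _. rewrite Rminus_diag, Rabs_R0; exact H. Qed.

Lemma topo_true : topo F (fun _ => True).
Proof. intros x _; exists nil, 1; split; [lra|auto]. Qed.

Lemma topo_inter U V : topo F U -> topo F V -> topo F (fun x => U x /\ V x).
Proof.
  intros HU HV x [Ux Vx].
  destruct (HU x Ux) as [l [e [e0 H]]], (HV x Vx) as [l' [e' [e0' H']]].
  exists (l ++ l'), (Rmin e e'); split; [apply Rmin_pos; auto|].
  intros y Hy; split; [apply H|apply H']; intros i Hi;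
    (eapply Rlt_le_trans; [apply Hy, in_or_app; auto|]).
  - apply Rmin_l.
  - apply Rmin_r.
Qed.

Lemma topo_union (S : (R -> Prop) -> Prop) : (forall U, S U -> topo F U) ->
  topo F (fun x => exists U, S U /\ U x).
Proof.
  intros H x [U [SU Ux]]. destruct (H U SU x Ux) as [l [e [e0 H']]].
  exists l, e; split; [exact e0|]. intros y Hy; exists U; auto.
Qed.

Lemma topo_is_topology : is_topology (topo F).
Proof.
  split; [apply topo_true|split; [|split; [apply topo_union|apply topo_inter]]].
  intros x [].
Qed.

Lemma topo_ext U V : (forall x, U x <-> V x) -> topo F U -> topo F V.
Proof.
  intros H HU x Vx. destruct (HU x) as [l [e [e0 H']]]; [apply H, Vx|].
  exists l, e; split; [exact e0|]. intros y Hy; apply H, H', Hy.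
Qed.

Lemma topo_forall {J} (l : list J) (P : J -> R -> Prop) :
  (forall j, In j l -> topo F (P j)) -> topo F (fun y => forall j, In j l -> P j y).
Proof.
  induction l as [|j l IH]; intros H.
  - apply topo_ext with (fun _ => True); [simpl; intuition|apply topo_true].
  - apply topo_ext with (fun y => P j y /\ forall k, In k l -> P k y).
    + intros x; simpl; split; [intros [A B] k [<-|Hk]; auto|intros A; split; auto].
    + apply topo_inter; [apply H; left; auto|apply IH; intros k Hk; apply H; right; auto].
Qed.

Lemma topo_interval i a b : topo F (fun y => a < F i y < b).
Proof.
  intros x Hx. exists (i :: nil), (Rmin (F i x - a) (b - F i x)); split; [apply Rmin_pos; lra|].
  intros y Hy. assert (A := Hy i (or_introl eq_refl)).
  assert (B := Rmin_l (F i x - a) (b - F i x)). assert (C := Rmin_r (F i x - a) (b - F i x)).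
  apply Rabs_def2 in A. lra.
Qed.

Lemma topo_near l eps x : topo F (near F l eps x).
Proof.
  apply topo_ext with (fun y => forall i, In i l -> F i x - eps < F i y < F i x + eps).
  - intros y; split; intros H i Hi.
    + specialize (H i Hi); simpl in H. apply Rabs_def1; lra.
    + specialize (H i Hi). apply Rabs_def2 in H. lra.
  - apply topo_forall; intros i _; apply topo_interval.
Qed.

(** This yields regularity: within a neighbourhood of radius eps, the box given by weak inequalities
    with radius eps / 2 is a closed neighbourhood. *)
Lemma topo_far l eps x : topo F (fun y => ~ forall i, In i l -> Rabs (F i y - F i x) <= eps).
Proof.
  intros y Hy. apply not_all_ex_not in Hy; destruct Hy as [i Hi].
  apply imply_to_and in Hi; destruct Hi as [Hi N]. apply Rnot_le_lt in N.
  exists (i :: nil), (Rabs (F i y - F i x) - eps); split; [lra|].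
  intros z Hz C. specialize (C i Hi). assert (D := Hz i (or_introl eq_refl)).
  assert (T := Rabs_triang (F i z - F i x) (F i y - F i z)).
  replace (F i z - F i x + (F i y - F i z)) with (F i y - F i x) in T by ring.
  rewrite (Rabs_minus_sym (F i y) (F i z)) in T. lra.
Qed.

Hypothesis F_cont : forall i, cont (F i).
Hypothesis F_sep : forall x y, x <> y -> exists i, F i x <> F i y.

Lemma near_eta l eps x : 0 < eps ->
  exists delta, 0 < delta /\ forall y, Rabs (y - x) < delta -> near F l eps x y.
Proof.
  intros e0; induction l as [|i l [d [d0 IH]]].
  - exists 1; split; [lra|]. intros y _ i [].
  - destruct (F_cont i x eps e0) as [d' [d0' H]].
    exists (Rmin d d'); split; [apply Rmin_pos; auto|].
    intros y Hy. assert (A := Rmin_l d d'). assert (B := Rmin_r d d').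
    intros k [<-|Hk]; [apply H; lra|apply IH; [lra|exact Hk]].
Qed.

Lemma topo_eta U x : topo F U -> U x ->
  exists delta, 0 < delta /\ forall y, Rabs (y - x) < delta -> U y.
Proof.
  intros HU Ux. destruct (HU x Ux) as [l [e [e0 H]]].
  destruct (near_eta l e x e0) as [d [d0 Hd]]. exists d; auto.
Qed.

Lemma topo_in_L : in_L (topo F).
Proof.
  split; [apply topo_is_topology|split].
  - intros x y xy. destruct (F_sep x y xy) as [i Hi].
    pose (e := Rabs (F i x - F i y) / 2).
    assert (e0 : 0 < e) by (unfold e; assert (0 < Rabs (F i x - F i y)) by (apply Rabs_pos_lt; lra); lra).
    exists (near F (i :: nil) e x), (near F (i :: nil) e y).
    split; [apply topo_near|split; [apply topo_near|split; [apply near_refl; auto|split; [apply near_refl; auto|]]]].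
    intros z Hx Hy. assert (A := Hx i (or_introl eq_refl)). assert (B := Hy i (or_introl eq_refl)).
    assert (T := Rabs_triang (F i z - F i y) (F i x - F i z)).
    replace (F i z - F i y + (F i x - F i z)) with (F i x - F i y) in T by ring.
    rewrite (Rabs_minus_sym (F i x) (F i z)) in T. unfold e in *; lra.
  - intros U HU x Ux. destruct (topo_eta U x HU Ux) as [d [d0 H]].
    exists (mkposreal d d0). intros y Hy. apply H, Hy.
Qed.

(* Second countability of the Euclidean topology, applied to a cover by coarser open sets. *)
Lemma countable_subcover (A : R -> Prop) (P : (R -> Prop) -> (R -> Prop) -> Prop) :
  (forall x, A x -> exists U D, topo F U /\ U x /\ P U D) ->
  exists U D : nat -> R -> Prop,
    (forall n, topo F (U n) /\ (P (U n) (D n) \/ ((forall x, ~ U n x) /\ (forall x, ~ D n x)))) /\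
    forall x, A x -> exists n, U n x.
Proof.
  intros H.
  pose (Q := fun n (p : (R -> Prop) * (R -> Prop)) =>
     topo F (fst p) /\ P (fst p) (snd p) /\
     forall y, q (fst (of_nat n)) < y < q (snd (of_nat n)) -> fst p y).
  (* A rational interval that lies in no suitable U receives a pair of empty sets, whence the
     alternative in the statement. *)
  destruct (functional_choice (fun n p => Q n p \/
     ((forall p, ~ Q n p) /\ p = (fun _ => False, fun _ => False)))) as [g Hg].
  { intros n; destruct (classic (exists p, Q n p)) as [[p Hp]|N].
    - exists p; auto.
    - eexists; right; split; [intros p Hp; apply N; eauto|reflexivity]. }
  exists (fun n => fst (g n)), (fun n => snd (g n)); split.
  - intros n; destruct (Hg n) as [[H1 [H2 _]]|[_ E]]; [auto|].
    rewrite E; split; [intros x []|right; split; auto].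
  - intros x Ax. destruct (H x Ax) as [U [D [HU [Ux HP]]]].
    destruct (topo_eta U x HU Ux) as [d [d0 Hd]].
    destruct (q_dense (x - d) x) as [a Ha]; [lra|].
    destruct (q_dense x (x + d)) as [b Hb]; [lra|].
    exists (to_nat (a, b)).
    destruct (Hg (to_nat (a, b))) as [[_ [_ H3]]|[N _]].
    + apply H3. rewrite cancel_of_to; simpl; lra.
    + exfalso; apply (N (U, D)). split; [exact HU|split; [exact HP|]].
      rewrite cancel_of_to; simpl; intros y Hy. apply Hd, Rabs_def1; lra.
Qed.

(** Tychonoff's argument that regular Lindelöf spaces are normal, carried out on every subspace.
    Both closed sets are covered by countably many open sets whose closed hulls miss the other one;
    from each open set the hulls of the other side with no larger index are removed. *)
Lemma topo_completely_normal : completely_normal (topo F).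
Proof.
  intros Y; split.
  - intros y Yy; split; [intros x ->; exact Yy|].
    exists (fun x => x <> y); split; [|intros x _; split; [intros ->; auto|intros N; apply NNPP, N]].
    intros x xy. destruct (F_sep x y xy) as [i Hi].
    exists (i :: nil), (Rabs (F i x - F i y)); split; [apply Rabs_pos_lt; lra|].
    intros z Hz ->. specialize (Hz i (or_introl eq_refl)).
    rewrite Rabs_minus_sym in Hz; lra.
  - intros A B [AY [OA [HOA EA]]] [BY [OB [HOB EB]]] AB.
    assert (shrink : forall (C E O : R -> Prop), topo F O -> subsetR C Y ->
        (forall x, Y x -> (E x <-> ~ O x)) -> (forall x, C x -> E x -> False) ->
        subsetR E Y ->
        exists U D : nat -> R -> Prop,
        (forall n, topo F (U n) /\ topo F (fun x => ~ D n x) /\ subsetR (U n) (D n) /\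
           forall x, E x -> ~ D n x) /\
        forall x, C x -> exists n, U n x).
    { intros C E O HO CY EO CE EY.
      destruct (countable_subcover C (fun U D => topo F (fun x => ~ D x) /\ subsetR U D /\
           forall x, E x -> ~ D x)) as [U [D [H1 H2]]].
      - intros x Cx.
        assert (Ox : O x) by (apply NNPP; intros N; apply (CE x Cx), EO; auto).
        destruct (HO x Ox) as [l [e [e0 He]]].
        exists (near F l (e / 2) x), (fun y => forall i, In i l -> Rabs (F i y - F i x) <= e / 2).
        split; [apply topo_near|split; [apply near_refl; lra|split; [apply topo_far|split]]].
        + intros y Hy i Hi; left; apply Hy, Hi.
        + intros y Ey Hy. apply (proj1 (EO y (EY y Ey)) Ey), He.
          intros i Hi; specialize (Hy i Hi); lra.
      - exists U, D; split; [|exact H2].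
        intros n; destruct (H1 n) as [T [[P1 [P2 P3]]|[N1 N2]]]; split; auto.
        split; [apply topo_ext with (fun _ => True); [intuition; eapply N2; eauto|apply topo_true]|].
        split; [intros x Hx; exfalso; eapply N1; eauto|intros; apply N2]. }
    destruct (shrink A B OB) as [U [C [UC HA]]]; auto.
    destruct (shrink B A OA) as [V [D [VD HB]]]; auto.
    { intros x b a; eapply AB; eauto. }
    assert (fin : forall (D : nat -> R -> Prop) n, (forall m, topo F (fun x => ~ D m x)) ->
        topo F (fun x => forall m, (m <= n)%nat -> ~ D m x)).
    { intros D' n H. apply topo_ext with (fun x => forall m, In m (seq 0 (S n)) -> ~ D' m x).
      - intros x; split; intros G m Hm; apply G; [apply in_seq; lia|apply in_seq in Hm; lia].
      - apply topo_forall; intros m _; apply H. }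
    assert (un : forall W : nat -> R -> Prop, (forall n, topo F (W n)) -> topo F (fun x => exists n, W n x)).
    { intros W HW x [n Wx]. destruct (HW n x Wx) as [l [e [e0 H]]].
      exists l, e; split; [exact e0|]. intros y Hy; exists n; auto. }
    exists (fun x => exists n, U n x /\ forall m, (m <= n)%nat -> ~ D m x),
           (fun x => exists n, V n x /\ forall m, (m <= n)%nat -> ~ C m x).
    split; [|split; [|split; [|split]]].
    + apply un; intros n; apply topo_inter; [apply UC|apply fin; intros m; apply VD].
    + apply un; intros n; apply topo_inter; [apply VD|apply fin; intros m; apply UC].
    + intros x Ax. destruct (HA x Ax) as [n Hn]. exists n; split; [exact Hn|].
      intros m _; apply VD, Ax.
    + intros x Bx. destruct (HB x Bx) as [n Hn]. exists n; split; [exact Hn|].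
      intros m _; apply UC, Bx.
    + intros x _ [n [Un Dn]] [m [Vm Cm]].
      destruct (Nat.le_gt_cases n m) as [L|L].
      * apply (Cm n L), UC, Un.
      * apply (Dn m); [lia|apply VD, Vm].
Qed.

Definition rational_box (l : list (I * (nat * nat))) : R -> Prop :=
  fun y => forall t, In t l -> q (fst (snd t)) < F (fst t) y < q (snd (snd t)).

Lemma rational_boxes_base : is_base (topo F) (fun b => exists l, rational_box l = b).
Proof.
  split.
  - intros b [l <-]. apply topo_forall; intros t _; apply topo_interval.
  - intros U x HU Ux. destruct (HU x Ux) as [l [e [e0 H]]].
    assert (G : exists l', rational_box l' x /\ forall y, rational_box l' y -> near F l e x y).
    { clear H. induction l as [|i l [l' [G1 G2]]].
      - exists nil; split; [intros t []|intros y _ i []].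
      - destruct (q_dense (F i x - e) (F i x)) as [a Ha]; [lra|].
        destruct (q_dense (F i x) (F i x + e)) as [b Hb]; [lra|].
        exists ((i, (a, b)) :: l'); split.
        + intros t [<-|Ht]; [simpl; lra|apply G1, Ht].
        + intros y Hy k [<-|Hk].
          * assert (A := Hy _ (or_introl eq_refl)); simpl in A. apply Rabs_def1; lra.
          * apply G2; [|exact Hk]. intros t Ht; apply Hy; right; exact Ht. }
    destruct G as [l' [G1 G2]].
    exists (rational_box l'); split; [eauto|split; [exact G1|]].
    intros y Hy; apply H, G2, Hy.
Qed.

(** The rational boxes are indexed by finite lists, so they form a base of at most |K| members;
    [Low] gives at least |K|. Cantor-Bernstein then turns this same base into one indexed
    injectively by K. *)
Lemma topo_weight (K : Type) : embeds nat K -> embeds I K ->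
  (forall B, is_base (topo F) B -> embeds K {b : R -> Prop | B b}) -> weight_eq (topo F) K.
Proof.
  intros Kinf IK Low. split; [|exact Low].
  pose (B := fun b => exists l, rational_box l = b).
  destruct (Cantor_Bernstein K {b : R -> Prop | B b}) as [h [h1 h2]].
  - apply Low, rational_boxes_base.
  - apply embeds_trans with (list (I * (nat * nat))).
    { destruct (functional_choice (fun (b : {b | B b}) l => rational_box l = proj1_sig b)) as [g Hg].
      - intros [b [l Hl]]; exists l; exact Hl.
      - exists g. intros [b Hb] [c Hc] E.
        assert (Eb := Hg (exist _ b Hb)); assert (Ec := Hg (exist _ c Hc)); simpl in Eb, Ec.
        assert (bc : b = c) by (rewrite <- Eb, <- Ec; f_equal; exact E).
        subst c. f_equal; apply proof_irrelevance. }
    apply embeds_trans with (list K); [|apply embeds_list, Kinf].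
    assert (P : embeds (I * (nat * nat)) K).
    { apply embeds_trans with (K * (K * K))%type; [repeat apply embeds_prod; auto|].
      apply embeds_trans with (K * K)%type; [|apply embeds_square, Kinf].
      apply embeds_prod; [exists (fun x => x); auto|apply embeds_square, Kinf]. }
    destruct P as [g Hg]. exists (map g).
    induction x as [|a x IH]; intros [|b y] E; try discriminate; auto.
    injection E; intros; f_equal; auto.
  - exists (fun k => proj1_sig (h k)); split.
    + intros i j E. apply h1. destruct (h i) as [b Hb], (h j) as [c Hc]; simpl in E.
      subst c; f_equal; apply proof_irrelevance.
    + destruct rational_boxes_base as [b1 b2]. split.
      * intros b [k <-]. apply b1, (proj2_sig (h k)).
      * intros U x HU Ux. destruct (b2 U x HU Ux) as [b [Bb Hb]].
        exists b; split; [|exact Hb].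
        destruct (h2 (exist _ b Bb)) as [k Hk]. exists k; rewrite Hk; reflexivity.
Qed.

End InitialTopology.

(** * Recursive piecewise linear functions *)

Definition interp (g : Z -> R) (x : R) : R :=
  g (Int_part x) + (x - IZR (Int_part x)) * (g (Int_part x + 1)%Z - g (Int_part x)).

Lemma Int_part_bounds x : IZR (Int_part x) <= x < IZR (Int_part x) + 1.
Proof. destruct (base_Int_part x); lra. Qed.

Lemma interp_on g n x : IZR n <= x <= IZR n + 1 ->
  interp g x = g n + (x - IZR n) * (g (n + 1)%Z - g n).
Proof.
  intros [H1 [H2|H2]]; unfold interp.
  - rewrite <- (Int_part_spec x n) by lra; reflexivity.
  - rewrite <- (Int_part_spec x (n + 1)) by (rewrite plus_IZR; lra).
    rewrite plus_IZR, H2; ring.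
Qed.

Lemma interp_IZR g n : interp g (IZR n) = g n.
Proof. rewrite (interp_on g n) by lra; ring. Qed.

(** This locality permits the definition of nodes by recursion on the absolute value of the
    integer. *)
Lemma interp_ext g g' N x : (forall k, (Z.abs k <= N)%Z -> g k = g' k) ->
  Rabs x <= IZR N -> interp g x = interp g' x.
Proof.
  intros H Hx. assert (X1 := Rle_abs x). assert (X2 := Rle_abs (- x)). rewrite Rabs_Ropp in X2. assert (B := Int_part_bounds x).
  destruct (Z_le_gt_dec (Int_part x + 1) N) as [L|L].
  - unfold interp. rewrite !H; [reflexivity| |].
    + assert (- N - 1 < Int_part x)%Z by (apply lt_IZR; rewrite minus_IZR, opp_IZR; lra). lia.
    + assert (- N - 1 < Int_part x)%Z by (apply lt_IZR; rewrite minus_IZR, opp_IZR; lra). lia.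
  - assert (Int_part x <= N)%Z by (apply le_IZR; lra).
    (* The remaining case is x = N, where the node N + 1 enters [interp] with coefficient zero. *)
    replace x with (IZR N) in *.
    + rewrite !interp_IZR. apply H. assert (0 <= N)%Z by (apply le_IZR; lra). lia.
    + assert (E : N = Int_part x) by lia. rewrite <- E in B; lra.
Qed.

Lemma interp_cont g : cont (interp g).
Proof.
  intros x eps e0. assert (B := Int_part_bounds x). set (n := Int_part x) in *.
  (* [C] exceeds the absolute slopes on both sides of n, since x may be n itself; eps / C then
     serves as delta near x. *)
  pose (C := Rabs (g (n + 1)%Z - g n) + Rabs (g n - g (n - 1)%Z) + 1).
  assert (A1 := Rabs_pos (g (n + 1)%Z - g n)). assert (A2 := Rabs_pos (g n - g (n - 1)%Z)).
  assert (C0 : 0 < C) by (unfold C; lra).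
  assert (lip : forall D d, Rabs D < C -> Rabs d < eps / C -> Rabs (d * D) < eps).
  { intros D d HD Hd. rewrite Rabs_mult.
    assert (P1 := Rabs_pos D). assert (P2 := Rabs_pos d).
    assert (E : eps / C * C = eps) by (field; lra). nra. }
  assert (K : 0 < eps / C) by (apply Rdiv_lt_0_compat; lra).
  destruct (Req_dec x (IZR n)) as [E|E].
  - exists (Rmin 1 (eps / C)); split; [apply Rmin_pos; lra|].
    intros y Hy. assert (M1 := Rmin_l 1 (eps / C)). assert (M2 := Rmin_r 1 (eps / C)).
    assert (Hy1 : Rabs (y - x) < 1) by lra. apply Rabs_def2 in Hy1.
    rewrite (interp_on g n x) by lra.
    destruct (Rle_dec x y) as [L|L].
    + rewrite (interp_on g n y) by lra.
      replace (g n + (y - IZR n) * (g (n + 1)%Z - g n) - (g n + (x - IZR n) * (g (n + 1)%Z - g n)))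
        with ((y - x) * (g (n + 1)%Z - g n)) by ring.
      apply lip; [unfold C; lra|lra].
    + rewrite (interp_on g (n - 1) y) by (rewrite minus_IZR; lra).
      replace (n - 1 + 1)%Z with n by lia. rewrite minus_IZR.
      replace (g (n - 1)%Z + (y - (IZR n - 1)) * (g n - g (n - 1)%Z) - (g n + (x - IZR n) * (g (n + 1)%Z - g n)))
        with ((y - x) * (g n - g (n - 1)%Z)) by (rewrite E; ring).
      apply lip; [unfold C; lra|lra].
  - pose (d := Rmin (Rmin (x - IZR n) (IZR n + 1 - x)) (eps / C)).
    assert (M1 := Rmin_l (Rmin (x - IZR n) (IZR n + 1 - x)) (eps / C)).
    assert (M2 := Rmin_r (Rmin (x - IZR n) (IZR n + 1 - x)) (eps / C)).
    assert (M3 := Rmin_l (x - IZR n) (IZR n + 1 - x)).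
    assert (M4 := Rmin_r (x - IZR n) (IZR n + 1 - x)).
    exists d; split; [unfold d; repeat apply Rmin_pos; lra|].
    intros y Hy. fold d in M1, M2.
    assert (Hy' := Hy). apply Rabs_def2 in Hy'.
    rewrite (interp_on g n x), (interp_on g n y) by lra.
    replace (g n + (y - IZR n) * (g (n + 1)%Z - g n) - (g n + (x - IZR n) * (g (n + 1)%Z - g n)))
        with ((y - x) * (g (n + 1)%Z - g n)) by ring.
    apply lip; [unfold C; lra|lra].
Qed.

(** Every rational is the target of infinitely many positive integers, and every mark that of
    infinitely many -(4 l + 2): the second component of the decoded pair is free to grow. All other
    integers have target 0. *)
Definition target (m : Z) : R :=
  if (0 <? m)%Z then q (fst (of_nat (Z.to_nat (m - 1))))
  else if (m mod 4 =? 2)%Z then IZR (- 4 * Z.of_nat (fst (of_nat (Z.to_nat (- m / 4)))))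
  else 0.

Lemma fst_of_nat_le n : (fst (of_nat n) <= n)%nat.
Proof.
  destruct (of_nat n) as [a b] eqn:E. assert (L := to_nat_non_decreasing a b).
  rewrite <- E, cancel_to_of in L. simpl; lia.
Qed.

(** A margin of 1 ensures that interpolation at [target m] uses only nodes of absolute value less
    than that of m, so the recursion is well founded. *)
Lemma target_bound m : m <> 0%Z -> Rabs (target m) <= IZR (Z.abs m - 1).
Proof.
  intros m0; unfold target.
  destruct (Z.ltb_spec 0 m) as [H|H]; [|destruct (Z.eqb_spec (m mod 4) 2) as [H'|H']].
  - eapply Rle_trans; [apply q_bound|]. rewrite INR_IZR_INZ. apply IZR_le.
    assert (L := fst_of_nat_le (Z.to_nat (m - 1))). lia.
  - rewrite <- abs_IZR. apply IZR_le. assert (L := fst_of_nat_le (Z.to_nat (- m / 4))).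
    Z.to_euclidean_division_equations; lia.
  - rewrite Rabs_R0. apply IZR_le. lia.
Qed.

Lemma target_neg n : target (- 4 * Z.of_nat n) = 0.
Proof.
  unfold target. destruct (Z.ltb_spec 0 (- 4 * Z.of_nat n)) as [H|H]; [lia|].
  destruct (Z.eqb_spec ((- 4 * Z.of_nat n) mod 4) 2) as [H'|H']; [|reflexivity].
  exfalso; Z.to_euclidean_division_equations; lia.
Qed.

Lemma target_src l : target (- (4 * Z.of_nat l + 2)) = IZR (- 4 * Z.of_nat (fst (of_nat l))).
Proof.
  unfold target. destruct (Z.ltb_spec 0 (- (4 * Z.of_nat l + 2))) as [H|H]; [lia|].
  replace (- (- (4 * Z.of_nat l + 2)) / 4)%Z with (Z.of_nat l) by (Z.to_euclidean_division_equations; lia).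
  rewrite Nat2Z.id.
  destruct (Z.eqb_spec ((- (4 * Z.of_nat l + 2)) mod 4) 2) as [H'|H']; [reflexivity|].
  exfalso; Z.to_euclidean_division_equations; lia.
Qed.

Lemma target_dense x d M : 0 < d -> exists m, (M < m)%Z /\ (0 < m)%Z /\ Rabs (target m - x) < d.
Proof.
  intros d0. destruct (q_dense (x - d) (x + d)) as [i Hi]; [lra|].
  exists (Z.of_nat (to_nat (i, Z.to_nat M)) + 1)%Z.
  assert (L := to_nat_non_decreasing i (Z.to_nat M)).
  split; [lia|split; [lia|]].
  unfold target. destruct (Z.ltb_spec 0 (Z.of_nat (to_nat (i, Z.to_nat M)) + 1)) as [H|H]; [|lia].
  rewrite Z.add_simpl_r, Nat2Z.id, cancel_of_to. apply Rabs_def1; simpl; lra.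
Qed.

Section Nodes.
Variables (B : Z -> bool) (v : Z -> R).
Hypothesis B0 : B 0%Z = true.

(** Where [B] holds the value [v] is prescribed; elsewhere the function copies its own value at
    [target m]. Fuel |m| suffices, and fuel 0 is then met only at m = 0, where [B] holds. *)
Fixpoint node_fuel (n : nat) (m : Z) : R :=
  match n with
  | O => v m
  | S n' => if B m then v m else interp (node_fuel n') (target m)
  end.

Definition node (m : Z) : R := node_fuel (Z.abs_nat m) m.

Lemma node_fuel_stable n : forall n' m, (Z.abs m <= Z.of_nat n)%Z -> (Z.abs m <= Z.of_nat n')%Z ->
  node_fuel n m = node_fuel n' m.
Proof.
  induction n as [|n IH]; intros [|n'] m H H'.
  - reflexivity.
  - replace m with 0%Z by lia. simpl; rewrite B0; reflexivity.
  - replace m with 0%Z by lia. simpl; rewrite B0; reflexivity.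
  - simpl. destruct (B m) eqn:Bm; [reflexivity|].
    assert (m0 : m <> 0%Z) by (intros ->; congruence).
    apply interp_ext with (Z.abs m - 1)%Z; [|apply target_bound, m0].
    intros k Hk; apply IH; lia.
Qed.

Lemma node_base m : B m = true -> node m = v m.
Proof.
  intros Bm; unfold node. destruct (Z.abs_nat m); simpl; [reflexivity|rewrite Bm; reflexivity].
Qed.

Lemma node_rec m : B m = false -> node m = interp node (target m).
Proof.
  intros Bm; unfold node at 1.
  assert (m0 : m <> 0%Z) by (intros ->; congruence).
  rewrite (node_fuel_stable (Z.abs_nat m) (S (Z.abs_nat m))) by lia.
  simpl; rewrite Bm. apply interp_ext with (Z.abs m - 1)%Z; [|apply target_bound, m0].
  intros k Hk; apply node_fuel_stable; lia.
Qed.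

End Nodes.

(* Far to the left, [level j false] and [level j true] differ by the distance to the even
   integers, so a point where both are close to x lies near an even integer; this keeps the
   left tail away from the points that are not marks. *)
Definition level_base (j : nat) (m : Z) : bool :=
  ((Z.abs m <=? Z.of_nat j) || (Z.odd m && (m <? 0)))%Z%bool.
Definition level_val (j : nat) (c : bool) (m : Z) : R :=
  if (Z.abs m <=? Z.of_nat j)%Z then IZR m else if c then 1 else 0.
Definition level (j : nat) (c : bool) : R -> R := interp (node (level_base j) (level_val j c)).

Lemma level_base0 j : level_base j 0 = true.
Proof. unfold level_base. destruct (Z.leb_spec (Z.abs 0) (Z.of_nat j)); [reflexivity|lia]. Qed.

(** Hence the levels separate points and yield the Euclidean topology on bounded sets. *)
Lemma level_id j c x : Rabs x <= INR j -> level j c x = x.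
Proof.
  intros Hx. unfold level.
  rewrite (interp_ext _ IZR (Z.of_nat j)); [|intros k Hk|rewrite <- INR_IZR_INZ; exact Hx].
  - unfold interp. rewrite plus_IZR; ring.
  - assert (L : (Z.abs k <=? Z.of_nat j)%Z = true) by (apply Z.leb_le, Hk).
    rewrite node_base; [unfold level_val; rewrite L; reflexivity|unfold level_base; rewrite L; reflexivity].
Qed.

Lemma level_rec j c m : (Z.of_nat j < Z.abs m)%Z -> (m < 0 -> Z.odd m = false)%Z ->
  level j c (IZR m) = level j c (target m).
Proof.
  intros Hm Ho. unfold level at 1. rewrite interp_IZR, node_rec; [reflexivity|apply level_base0|].
  unfold level_base. destruct (Z.leb_spec (Z.abs m) (Z.of_nat j)); [lia|].
  destruct (Z.ltb_spec m 0) as [L|L]; [rewrite Ho by lia; reflexivity|apply Bool.andb_false_r].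
Qed.

Lemma level_odd j c m : (Z.of_nat j < - m)%Z -> Z.odd m = true ->
  level j c (IZR m) = if c then 1 else 0.
Proof.
  intros Hm Ho. unfold level. rewrite interp_IZR, node_base.
  - unfold level_val. destruct (Z.leb_spec (Z.abs m) (Z.of_nat j)); [lia|reflexivity].
  - unfold level_base. destruct (Z.leb_spec (Z.abs m) (Z.of_nat j)); [reflexivity|].
    rewrite Ho. destruct (Z.ltb_spec m 0); [reflexivity|lia].
Qed.

Lemma level_on j c m y : IZR m <= y <= IZR m + 1 ->
  level j c y = level j c (IZR m) + (y - IZR m) * (level j c (IZR (m + 1)) - level j c (IZR m)).
Proof.
  intros H; unfold level. rewrite !interp_IZR. apply interp_on, H.
Qed.

Lemma odd_even_mult k : Z.odd (2 * k) = false.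
Proof. rewrite Z.odd_mul. reflexivity. Qed.

(** Far marks copy the value at 0, so a level does not tell them from 0; the filter that 0 induces
    on the marks is left to the traces. *)
Lemma level_mark j c n : (j < 4 * n)%nat -> level j c (IZR (- 4 * Z.of_nat n)) = 0.
Proof.
  intros H. rewrite level_rec; [|lia|].
  - rewrite target_neg. apply level_id. rewrite Rabs_R0; apply pos_INR.
  - intros _. replace (- 4 * Z.of_nat n)%Z with (2 * (- 2 * Z.of_nat n))%Z by lia. apply odd_even_mult.
Qed.

Lemma level_src j c l : (j < 4 * l + 2)%nat ->
  level j c (IZR (- (4 * Z.of_nat l + 2))) = level j c (IZR (- 4 * Z.of_nat (fst (of_nat l)))).
Proof.
  intros H. rewrite level_rec; [|lia|].
  - rewrite target_src; reflexivity.
  - intros _. replace (- (4 * Z.of_nat l + 2))%Z with (2 * (- 2 * Z.of_nat l - 1))%Z by lia. apply odd_even_mult.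
Qed.

(** * Functions with prescribed zeros among the marks *)

Definition trace_base (m : Z) : bool := ((m <=? 0) && (m mod 4 =? 0))%Z%bool.
(** The node 0 has value 0 even if A misses 0, because neighbourhoods of the point 0 are read off
    from the zeros. For m = -4 n the quotient recovers n. *)
Definition trace_val (A : nat -> Prop) (m : Z) : R :=
  if (m =? 0)%Z then 0
  else if excluded_middle_informative (A (Z.to_nat (- m / 4))) then 0 else 1.
Definition trace (A : nat -> Prop) : R -> R := interp (node trace_base (trace_val A)).

Lemma trace_mark A n : trace A (IZR (- 4 * Z.of_nat n)) = trace_val A (- 4 * Z.of_nat n).
Proof.
  unfold trace. rewrite interp_IZR, node_base; [reflexivity|].
  unfold trace_base. apply andb_true_intro; split; [apply Z.leb_le; lia|].
  apply Z.eqb_eq. Z.to_euclidean_division_equations; lia.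
Qed.

Lemma trace_0 A : trace A 0 = 0.
Proof. apply (trace_mark A 0). Qed.

Lemma trace_in (A : nat -> Prop) n : A n -> trace A (IZR (- 4 * Z.of_nat n)) = 0.
Proof.
  intros H. rewrite trace_mark; unfold trace_val.
  destruct (Z.eqb_spec (- 4 * Z.of_nat n) 0); [reflexivity|].
  replace (- (- 4 * Z.of_nat n) / 4)%Z with (Z.of_nat n) by (Z.to_euclidean_division_equations; lia).
  rewrite Nat2Z.id. destruct (excluded_middle_informative (A n)); tauto.
Qed.

Lemma trace_out (A : nat -> Prop) n : (0 < n)%nat -> ~ A n -> trace A (IZR (- 4 * Z.of_nat n)) = 1.
Proof.
  intros n0 H. rewrite trace_mark; unfold trace_val.
  destruct (Z.eqb_spec (- 4 * Z.of_nat n) 0); [lia|].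
  replace (- (- 4 * Z.of_nat n) / 4)%Z with (Z.of_nat n) by (Z.to_euclidean_division_equations; lia).
  rewrite Nat2Z.id. destruct (excluded_middle_informative (A n)); tauto.
Qed.

Lemma trace_rec A m : trace_base m = false -> trace A (IZR m) = trace A (target m).
Proof.
  intros H. unfold trace at 1. rewrite interp_IZR, node_rec; [reflexivity|reflexivity|exact H].
Qed.

Lemma trace_pos A m : (0 < m)%Z -> trace A (IZR m) = trace A (target m).
Proof.
  intros H. apply trace_rec. unfold trace_base. destruct (Z.leb_spec m 0); [lia|reflexivity].
Qed.

Lemma trace_src A l :
  trace A (IZR (- (4 * Z.of_nat l + 2))) = trace A (IZR (- 4 * Z.of_nat (fst (of_nat l)))).
Proof.
  rewrite trace_rec, target_src; [reflexivity|].
  unfold trace_base. apply Bool.andb_false_iff; right. apply Z.eqb_neq.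
  Z.to_euclidean_division_equations; lia.
Qed.

(** * An independent family of subsets of nat *)

Fixpoint decode_list (fuel n : nat) : list nat :=
  match fuel, n with
  | S f, S n' => let (a, b) := of_nat n' in a :: decode_list f b
  | _, _ => nil
  end.

(** The bound on the head allows padding to enlarge a code. Stability for all larger fuel carries
    the induction, where the tail has a smaller code and one unit of fuel less. *)
Lemma decode_list_surj (l : list nat) :
  exists n, (forall a, head l = Some a -> (a <= n)%nat) /\ forall f, (n <= f)%nat -> decode_list f n = l.
Proof.
  induction l as [|a l [n [_ IH]]].
  - exists 0%nat; split; [discriminate|]. intros [|f] _; reflexivity.
  - assert (L := to_nat_non_decreasing a n).
    exists (S (to_nat (a, n))); split.
    + intros a' E; injection E; intros; subst; lia.
    + intros [|f] Hf; [lia|]. cbn [decode_list]. rewrite cancel_of_to, IH by lia; reflexivity.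
Qed.

(* [n] codes a finite union of rational intervals; the head of the decoded list is
   padding, so that every finite union has arbitrarily large codes. *)
Definition covers (x : R) (n : nat) : Prop :=
  exists i, In i (tl (decode_list n n)) /\ q (fst (of_nat i)) < x < q (snd (of_nat i)).

(** As Q is finite, each point of P lies in a rational interval too short to reach Q. The list of
    these intervals, padded by M, has a code of at least M. *)
Lemma covers_independent (P Q : list R) : (forall x, In x P -> ~ In x Q) ->
  forall M, exists n, (M <= n)%nat /\ (forall x, In x P -> covers x n) /\ (forall x, In x Q -> ~ covers x n).
Proof.
  intros H M.
  assert (G : exists l : list nat,
     (forall x, In x P -> exists i, In i l /\ q (fst (of_nat i)) < x < q (snd (of_nat i))) /\
     (forall x i, In x Q -> In i l -> ~ q (fst (of_nat i)) < x < q (snd (of_nat i)))).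
  { induction P as [|p P IH].
    - exists nil; split; [intros x []|intros x i _ []].
    - destruct IH as [l [H1 H2]]; [intros x Hx; apply H; right; exact Hx|].
      assert (S : exists d, 0 < d /\ forall x, In x Q -> d <= Rabs (x - p)).
      { assert (N : ~ In p Q) by (apply H; left; reflexivity).
        clear - N. induction Q as [|a Q IH]; [exists 1; split; [lra|intros x []]|].
        destruct IH as [d [d0 Hd]]; [intros C; apply N; right; exact C|].
        assert (A : a <> p) by (intros C; apply N; left; exact C).
        exists (Rmin d (Rabs (a - p))); split; [apply Rmin_pos; [lra|apply Rabs_pos_lt; lra]|].
        intros x [<-|Hx]; [apply Rmin_r|eapply Rle_trans; [apply Rmin_l|auto]]. }
      destruct S as [d [d0 Hd]].
      destruct (q_dense (p - d) p) as [a Ha]; [lra|]. destruct (q_dense p (p + d)) as [b Hb]; [lra|].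
      exists (to_nat (a, b) :: l); split.
      + intros x [<-|Hx].
        * exists (to_nat (a, b)); split; [left; reflexivity|]. rewrite cancel_of_to; simpl; lra.
        * destruct (H1 x Hx) as [i [Hi Hi']]; exists i; split; [right; exact Hi|exact Hi'].
      + intros x i Qx [<-|Hi] C; [|eapply H2; eauto].
        rewrite cancel_of_to in C; simpl in C. specialize (Hd x Qx).
        assert (Rabs (x - p) < d) by (apply Rabs_def1; lra). lra. }
  destruct G as [l [H1 H2]].
  destruct (decode_list_surj (M :: l)) as [n [Mn Hn]].
  exists n; split; [apply Mn; reflexivity|]. unfold covers; rewrite Hn by lia; simpl tl. split.
  - exact H1.
  - intros x Qx [i [Hi C]]; eapply H2; eauto.
Qed.

(** Injectivity of [e] keeps the points with [s k = true] apart from those with [s k = false]. The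
    sets of codes that cover [e k] are thus an independent family of
    Fichtenholz-Kantorovich-Hausdorff kind. *)
Lemma covers_independent_family (K : Type) (e : K -> R) (e_inj : forall i j, e i = e j -> i = j)
    (s : K -> bool) (L : list K) (M : nat) :
  exists n, (M <= n)%nat /\ forall k, In k L -> (covers (e k) n <-> s k = true).
Proof.
  destruct (covers_independent (map e (filter s L)) (map e (filter (fun k => negb (s k)) L))) with (M := M)
    as [n [Mn [H1 H2]]].
  - intros x Hx Hx'. apply in_map_iff in Hx, Hx'.
    destruct Hx as [k [E Hk]], Hx' as [k' [E' Hk']]. apply filter_In in Hk, Hk'.
    assert (k = k') by (apply e_inj; congruence). subst k'.
    destruct Hk as [_ A], Hk' as [_ B]. rewrite A in B; discriminate.
  - exists n; split; [exact Mn|]. intros k Hk. destruct (s k) eqn:E; split; auto.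
    + intros _. apply H1, in_map, filter_In; auto.
    + intros C; exfalso. apply (H2 (e k)); [|exact C]. apply in_map, filter_In. rewrite E; auto.
    + discriminate.
Qed.

(** * Sierpinski's theorem and monotonicity *)

(** Disjointness is weakened to the condition that cells which meet coincide, because the cells will
    be indexed by rationals, with repetitions. *)
Definition closed_cells (a b : R) (F : nat -> R -> Prop) : Prop :=
  (forall n x, a <= x <= b -> ~ F n x ->
     exists d, 0 < d /\ forall y, a <= y <= b -> Rabs (y - x) < d -> ~ F n y) /\
  (forall x, a <= x <= b -> exists n, F n x) /\
  (forall n m x y, a <= x <= b -> a <= y <= b -> F n x -> F m x -> F n y -> F m y).

(** Let v be the first point of cell n to the right of x. The cell m of x cannot contain all of [x,
    v): being closed it would contain v and so coincide with cell n. A point t < v outside cell m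
    gives the interval [x, t]. *)
Lemma cells_right a b F n x w : closed_cells a b F -> a <= x -> x < w -> w <= b ->
  ~ F n x -> F n w ->
  exists m t, x <= t <= w /\ F m x /\ ~ F m t /\ forall z, x <= z <= t -> ~ F n z.
Proof.
  intros [Fcl [Fcov Fdis]] ax xw wb nx nw.
  pose (E := fun z => x <= z <= w /\ forall y, x <= y <= z -> ~ F n y).
  assert (Ex : E x) by (split; [lra|intros y Hy; replace y with x by lra; exact nx]).
  destruct (completeness E) as [v [v1 v2]].
  { exists w; intros z [Hz _]; lra. }
  { exists x; exact Ex. }
  assert (xv : x <= v) by (apply v1, Ex).
  assert (vw : v <= w) by (apply v2; intros z [Hz _]; lra).
  assert (below : forall y, x <= y < v -> ~ F n y).
  { intros y Hy Fy. assert (v <= y); [|lra]. apply v2. intros z [Hz1 Hz2].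
    apply Rnot_lt_le; intros yz. apply (Hz2 y); [lra|exact Fy]. }
  assert (nv : F n v).
  { apply NNPP; intros N. destruct (Fcl n v) as [d [d0 Hd]]; [lra|exact N|].
    assert (vw' : v < w) by (destruct vw as [L|L]; [exact L|subst; tauto]).
    assert (M1 := Rmin_l (d / 2) (w - v)). assert (M2 := Rmin_r (d / 2) (w - v)).
    assert (M3 : 0 < Rmin (d / 2) (w - v)) by (apply Rmin_pos; lra).
    assert (v + Rmin (d / 2) (w - v) <= v); [|lra]. apply v1. split; [lra|].
    intros y Hy. destruct (Rlt_dec y v) as [L|L]; [apply below; lra|].
    apply Hd; [lra|]. apply Rabs_def1; lra. }
  assert (xv' : x < v) by (destruct xv as [L|L]; [exact L|subst; tauto]).
  destruct (Fcov x) as [m mx]; [lra|].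
  assert (T : exists t, x <= t < v /\ ~ F m t).
  { apply NNPP; intros N.
    assert (all : forall t, x <= t < v -> F m t) by (intros t Ht; apply NNPP; intros C; apply N; eauto).
    assert (mv : F m v).
    { apply NNPP; intros C. destruct (Fcl m v) as [d [d0 Hd]]; [lra|exact C|].
      assert (M1 := Rmin_l (d / 2) (v - x)). assert (M2 := Rmin_r (d / 2) (v - x)).
      assert (M3 : 0 < Rmin (d / 2) (v - x)) by (apply Rmin_pos; lra).
      apply (Hd (v - Rmin (d / 2) (v - x))); [lra|apply Rabs_def1; lra|apply all; lra]. }
    apply nx. apply (Fdis m n v x); auto; lra. }
  destruct T as [t [Ht mt]]. exists m, t. split; [lra|split; [exact mx|split; [exact mt|]]].
  intros z Hz; apply below; lra.
Qed.

Lemma closed_cells_opp a b F : closed_cells a b F -> closed_cells (- b) (- a) (fun n x => F n (- x)).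
Proof.
  intros [Fcl [Fcov Fdis]]; split; [|split].
  - intros n x Hx N. destruct (Fcl n (- x)) as [d [d0 Hd]]; [lra|exact N|].
    exists d; split; [exact d0|]. intros y Hy Hyx. apply Hd; [lra|].
    replace (- y - - x) with (- (y - x)) by ring. rewrite Rabs_Ropp; exact Hyx.
  - intros x Hx; apply Fcov; lra.
  - intros n m x y Hx Hy; apply Fdis; lra.
Qed.

(* An interval meeting two cells contains one which still meets two cells but misses
   a prescribed cell; a nested intersection would then miss all the cells. *)
Lemma Sierpinski a b F : closed_cells a b F ->
  forall n x y, a <= x <= b -> a <= y <= b -> F n x -> F n y.
Proof.
  intros HF n0 x0 y0 Hx0 Hy0 nx0. apply NNPP; intros ny0.
  assert (HF' := HF). destruct HF' as [Fcl [Fcov Fdis]].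
  pose (bad := fun p : R * R => a <= fst p /\ snd p <= b /\
     exists n x y, fst p <= x <= snd p /\ fst p <= y <= snd p /\ F n x /\ ~ F n y).
  assert (step : forall n p, exists p', bad p -> bad p' /\ fst p <= fst p' /\ snd p' <= snd p /\
      forall z, fst p' <= z <= snd p' -> ~ F n z).
  { intros n p. destruct (classic (bad p)) as [Hp|N]; [|exists p; tauto].
    destruct p as [u v]. destruct Hp as [au [vb [m [x [y [Hx [Hy [mx my]]]]]]]]; simpl in *.
    destruct (classic (forall z, u <= z <= v -> ~ F n z)) as [A|A].
    { exists (u, v); intros _; split; [|simpl; split; [lra|split; [lra|exact A]]].
      split; [|split]; simpl; auto. exists m, x, y; auto. }
    apply not_all_ex_not in A; destruct A as [w A]. apply imply_to_and in A.
    destruct A as [Hw nw]; apply NNPP in nw.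
    assert (X : exists x', u <= x' <= v /\ ~ F n x').
    { destruct (classic (F n x)) as [nx|nx]; [|eauto].
      exists y; split; [exact Hy|]. intros ny. apply my. apply (Fdis n m x y); auto; lra. }
    destruct X as [x' [Hx' nx']].
    destruct (Rtotal_order x' w) as [L|[L|L]].
    - destruct (cells_right a b F n x' w) as [m' [t [Ht [Hm1 [Hm2 Hm3]]]]]; auto; try lra.
      exists (x', t); intros _; simpl. split; [|split; [lra|split; [lra|exact Hm3]]].
      split; [simpl; lra|split; [simpl; lra|]]. exists m', x', t; simpl; repeat split; auto; lra.
    - subst; tauto.
    - destruct (cells_right (- b) (- a) (fun n x => F n (- x)) n (- x') (- w)) as [m' [t [Ht [Hm1 [Hm2 Hm3]]]]];
        try lra; try (rewrite Ropp_involutive; assumption).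
      { apply closed_cells_opp, HF. }
      exists (- t, x'); intros _; simpl. rewrite Ropp_involutive in Hm1.
      split; [|split; [lra|split; [lra|]]].
      + split; [simpl; lra|split; [simpl; lra|]]. exists m', x', (- t); simpl; repeat split; auto; lra.
      + intros z Hz. specialize (Hm3 (- z)). rewrite Ropp_involutive in Hm3. apply Hm3; lra. }
  destruct (functional_choice (fun (np : nat * (R * R)) p' => bad (snd np) ->
     bad p' /\ fst (snd np) <= fst p' /\ snd p' <= snd (snd np) /\
      forall z, fst p' <= z <= snd p' -> ~ F (fst np) z)) as [g Hg].
  { intros [n p]; apply step. }
  pose (I := fix I n := match n with O => (a, b) | S n' => g (n', I n') end).
  assert (bI : forall n, bad (I n)).
  { induction n as [|n IH].
    - simpl; split; [simpl; lra|split; [simpl; lra|exists n0, x0, y0; simpl; auto]].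
    - apply (Hg (n, I n)), IH. }
  assert (nest : forall n m, (n <= m)%nat -> fst (I n) <= fst (I m) /\ snd (I m) <= snd (I n)).
  { intros n m L; induction L as [|m L IH]; [lra|].
    destruct (Hg (m, I m) (bI m)) as [_ [G1 [G2 _]]]. simpl fst in G1, G2; simpl snd in G1, G2.
    change (I (S m)) with (g (m, I m)). lra. }
  assert (ne : forall n, fst (I n) <= snd (I n)).
  { intros n; destruct (bI n) as [_ [_ [? [? [? [? _]]]]]]; lra. }
  destruct (completeness (fun z => exists n, z = fst (I n))) as [z [z1 z2]].
  { exists b. intros z [n ->]. destruct (bI n) as [_ [B _]]. specialize (ne n); lra. }
  { exists a, 0%nat; reflexivity. }
  assert (zI : forall n, fst (I n) <= z <= snd (I n)).
  { intros n; split; [apply z1; eauto|]. apply z2. intros y [m ->].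
    destruct (Nat.le_ge_cases n m) as [L|L]; destruct (nest _ _ L); assert (nm := ne m); assert (nn := ne n); lra. }
  destruct (Fcov z) as [m mz].
  { specialize (zI 0%nat); simpl in zI; lra. }
  destruct (Hg (m, I m) (bI m)) as [_ [_ [_ G]]]. apply (G z); [apply (zI (S m))|exact mz].
Qed.

Lemma cont_continuity f : cont f -> continuity f.
Proof.
  intros H x eps e0. destruct (H x eps e0) as [d [d0 Hd]].
  exists d; split; [exact d0|]. intros y [_ Hy]. apply Hd, Hy.
Qed.

(** Deform one pair a < b linearly into another pair c < d. The two points never meet, so by
    injectivity the difference of their images never vanishes, and by the intermediate value theorem
    it keeps its sign. *)
Lemma cont_injective_monotone h : cont h -> (forall x y, h x = h y -> x = y) ->
  (forall x y, x < y -> h x < h y) \/ (forall x y, x < y -> h y < h x).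
Proof.
  intros Hc Hi. apply cont_continuity in Hc.
  assert (same : forall a b c d, a < b -> c < d -> h a < h b -> h c < h d).
  { intros a b c d ab cd hab. apply Rnot_le_lt; intros hcd.
    pose (f := fun t => h (b + t * (d - b)) - h (a + t * (c - a))).
    assert (Hf : continuity f).
    { apply continuity_minus; apply (continuity_comp _ h); auto; reg. }
    destruct (IVT_cor f 0 1 Hf) as [t [Ht E]]; [lra| |].
    - unfold f. replace (b + 0 * (d - b)) with b by ring. replace (a + 0 * (c - a)) with a by ring.
      replace (b + 1 * (d - b)) with d by ring. replace (a + 1 * (c - a)) with c by ring. nra.
    - unfold f in E. assert (E' : b + t * (d - b) = a + t * (c - a)) by (apply Hi; lra).
      destruct (Rle_dec t (1 / 2)); nra. }
  destruct (Rtotal_order (h 0) (h 1)) as [L|[L|L]].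
  - left; intros x y xy. apply (same 0 1); auto; lra.
  - apply Hi in L; lra.
  - right; intros x y xy. apply Rnot_le_lt; intros [C|C].
    + assert (h 0 < h 1) by (apply (same x y); auto; lra). lra.
    + apply Hi in C; lra.
Qed.

(** * The topologies *)

Definition mark (n : nat) : R := IZR (- 4 * Z.of_nat n).

Lemma large_nat x : exists j, Rabs x <= INR j.
Proof.
  destruct (INR_unbounded (Rabs x)) as [j Hj]. exists j; lra.
Qed.

(** Multiples of 4 copy 0. The other even integers copy a mark, which lies in the range where the
    level is the identity or else itself copies 0. The value is the same for both [c]. *)
Lemma level_even j m : (Z.of_nat j < - m)%Z -> Z.odd m = false ->
  exists n, (4 * n <= j)%nat /\ forall c, level j c (IZR m) = mark n.
Proof.
  intros Hm Ho.
  assert (id : forall n c, (4 * n <= j)%nat -> level j c (mark n) = mark n).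
  { intros n c L; apply level_id. unfold mark. rewrite <- abs_IZR, INR_IZR_INZ. apply IZR_le; lia. }
  rewrite <- Z.negb_even, Bool.negb_false_iff, Z.even_spec in Ho. destruct Ho as [p Hp].
  destruct (Z.Even_or_Odd p) as [[k Hk]|[k Hk]].
  - exists 0%nat; split; [lia|]. intros c.
    replace m with (- 4 * Z.of_nat (Z.to_nat (- k)))%Z by lia.
    rewrite level_mark by lia. reflexivity.
  - replace m with (- (4 * Z.of_nat (Z.to_nat (- k - 1)) + 2))%Z by lia.
    set (l := Z.to_nat (- k - 1)).
    destruct (Nat.le_gt_cases (4 * fst (of_nat l)) j) as [L|L].
    + exists (fst (of_nat l)); split; [exact L|]. intros c.
      rewrite level_src by lia. apply id, L.
    + exists 0%nat; split; [lia|]. intros c.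
      rewrite level_src, level_mark by lia. reflexivity.
Qed.

Section Topologies.
Context {K : Type} (e : K -> R).

(** The set given to [trace] is the k-th member of the independent family or its complement,
    according to [s k]. *)
Definition family (s : K -> bool) (i : nat * bool + K) : R -> R :=
  match i with
  | inl (j, c) => level j c
  | inr k => trace (fun n => covers (e k) n <-> s k = true)
  end.

Definition tau (s : K -> bool) : (R -> Prop) -> Prop := topo (family s).

Lemma family_cont s i : cont (family s i).
Proof. destruct i as [[j c]|k]; apply interp_cont. Qed.

Lemma family_sep s x y : x <> y -> exists i, family s i x <> family s i y.
Proof.
  intros xy. destruct (large_nat x) as [j Hj], (large_nat y) as [j' Hj'].
  assert (A := le_INR _ _ (Nat.le_max_l j j')). assert (B := le_INR _ _ (Nat.le_max_r j j')).
  exists (inl (Nat.max j j', false)); simpl. rewrite !level_id by lra. exact xy.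
Qed.

Lemma level_bound (l : list (nat * bool + K)) : exists J, forall j c, In (inl (j, c)) l -> (j <= J)%nat.
Proof.
  induction l as [|[[j c]|k] l [J HJ]].
  - exists 0%nat; intros j c [].
  - exists (Nat.max j J). intros j' c' [E|H].
    + injection E; intros; lia.
    + apply HJ in H; lia.
  - exists J; intros j c [E|H]; [discriminate|eauto].
Qed.

Lemma tau_eta s U x : tau s U -> U x -> exists d, 0 < d /\ forall y, Rabs (y - x) < d -> U y.
Proof. apply topo_eta, family_cont. Qed.

(** A basic neighbourhood involves finitely many functions. Beyond their levels, a positive integer
    whose target is close to x has the same values as that target. *)
Lemma tau_unbounded_above s U x M : tau s U -> U x -> exists y, M < y /\ U y.
Proof.
  intros HU Ux. destruct (HU x Ux) as [l [eps [e0 H]]].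
  destruct (near_eta (family s) (family_cont s) l eps x e0) as [d [d0 Hd]].
  destruct (level_bound l) as [J HJ].
  destruct (target_dense x d (Z.max (Z.of_nat J) (up M)) d0) as [m [mM [m0 Hm]]].
  exists (IZR m); split.
  - destruct (archimed M) as [A _]. assert (IZR (up M) < IZR m) by (apply IZR_lt; lia). lra.
  - apply H. intros i Hi.
    replace (family s i (IZR m)) with (family s i (target m)) by
      (destruct i as [[j c]|k]; symmetry;
       [apply level_rec; [apply HJ in Hi; lia|lia]|apply trace_pos, m0]).
    apply Hd; [exact Hm|exact Hi].
Qed.

(** A single level is the identity on a range containing a, b and x, so it keeps x away from all of
    [a, b]. *)
Lemma tau_outside s a b : tau s (fun x => ~ (a <= x <= b)).
Proof.
  intros x Hx. destruct (large_nat x) as [j1 H1], (large_nat a) as [j2 H2], (large_nat b) as [j3 H3].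
  pose (j := (j1 + j2 + j3)%nat).
  assert (E : INR j = INR j1 + INR j2 + INR j3) by (unfold j; rewrite !plus_INR; reflexivity).
  assert (P1 := pos_INR j1). assert (P2 := pos_INR j2). assert (P3 := pos_INR j3).
  assert (id : forall z, Rabs z <= INR j -> level j false z = z) by (intros; apply level_id; auto).
  assert (A1 := Rle_abs a). assert (A2 := Rle_abs (- a)). rewrite Rabs_Ropp in A2.
  assert (B1 := Rle_abs b). assert (B2 := Rle_abs (- b)). rewrite Rabs_Ropp in B2.
  assert (N : x < a \/ b < x \/ b < a) by lra.
  assert (G : exists eps, 0 < eps /\ forall y, a <= y <= b -> eps <= Rabs (y - x)).
  { destruct N as [L|[L|L]].
    - exists (a - x); split; [lra|]. intros y Hy. rewrite Rabs_pos_eq; lra.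
    - exists (x - b); split; [lra|]. intros y Hy. rewrite Rabs_minus_sym, Rabs_pos_eq; lra.
    - exists 1; split; [lra|intros y Hy; lra]. }
  destruct G as [eps [e0 G]].
  exists (inl (j, false) :: nil), eps; split; [exact e0|].
  intros y Hy C. specialize (Hy _ (or_introl eq_refl)); simpl in Hy.
  rewrite (id x), (id y) in Hy by (lra || (apply Rabs_le; lra)). specialize (G y C); lra.
Qed.

Lemma tau_first_category s : first_category (tau s).
Proof.
  exists (fun n x => - INR n <= x <= INR n); split.
  - intros n U HU Ucl x Ux.
    destruct (tau_unbounded_above s U x (INR n) HU Ux) as [y [ny Uy]].
    destruct (Ucl y Uy (fun z => ~ (- INR n <= z <= INR n))) as [z [H1 H2]].
    + apply tau_outside.
    + lra.
    + tauto.
  - intros x. destruct (large_nat x) as [n Hn]. exists n.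
    assert (A1 := Rle_abs x). assert (A2 := Rle_abs (- x)). rewrite Rabs_Ropp in A2. lra.
Qed.

(** A unit neighbourhood for one level omits far integers on both sides: on the right those copying
    a point near x + 2, on the left odd ones of value 0 if |x| >= 1, and copies of the mark -4
    otherwise. *)
Lemma tau_gaps s x : exists W, tau s W /\ W x /\
  forall M, (exists p, M < p /\ ~ W p) /\ (exists p, p < M /\ ~ W p).
Proof.
  destruct (large_nat x) as [j0 H0].
  (* The extra 4 brings -4 and the points within 1 of x + 2 into the range where the level is the
     identity. *)
  pose (j := (j0 + 4)%nat).
  assert (E : INR j = INR j0 + 4) by (unfold j; rewrite plus_INR; simpl; lra).
  assert (A1 := Rle_abs x). assert (A2 := Rle_abs (- x)). rewrite Rabs_Ropp in A2.
  assert (lx : level j false x = x) by (apply level_id; lra).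
  exists (near (family s) (inl (j, false) :: nil) 1 x).
  split; [apply topo_near|split; [apply near_refl; lra|]].
  assert (far : forall p, 1 <= Rabs (level j false p - x) -> ~ near (family s) (inl (j, false) :: nil) 1 x p).
  { intros p Hp C. specialize (C _ (or_introl eq_refl)); simpl in C. rewrite lx in C; lra. }
  intros M; destruct (archimed M) as [M1 M2]; split.
  - destruct (target_dense (x + 2) 1 (Z.max (Z.of_nat j) (up M))) as [m [mM [m0 Hm]]]; [lra|].
    apply Rabs_def2 in Hm.
    exists (IZR m); split; [assert (IZR (up M) < IZR m) by (apply IZR_lt; lia); lra|].
    apply far. rewrite level_rec by lia. rewrite level_id by (apply Rabs_le; lra).
    rewrite Rabs_pos_eq; lra.
  - assert (lowM : forall m, (m < up M - 1)%Z -> IZR m < M).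
    { intros m Hm. apply IZR_lt in Hm. rewrite minus_IZR in Hm. lra. }
    pose (N := Z.to_nat (Z.abs (up M) + Z.of_nat j + 4)).
    destruct (Rle_dec 1 (Rabs x)) as [L|L].
    + exists (IZR (- (2 * Z.of_nat N + 1))). split; [apply lowM; lia|].
      apply far. rewrite level_odd; [rewrite Rminus_0_l, Rabs_Ropp; exact L|lia|].
      replace (- (2 * Z.of_nat N + 1))%Z with (1 + 2 * (- Z.of_nat N - 1))%Z by lia.
      apply Z.odd_add_mul_2.
    + assert (T := to_nat_non_decreasing 1 N). set (l := to_nat (1%nat, N)) in *.
      exists (IZR (- (4 * Z.of_nat l + 2))). split; [apply lowM; lia|].
      apply far. rewrite level_src by lia. unfold l; rewrite cancel_of_to.
      change (IZR (- 4 * Z.of_nat (fst (1%nat, N)))) with (-4).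
      apply Rnot_le_lt, Rabs_def2 in L.
      rewrite level_id by (apply Rabs_le; assert (P := pos_INR j0); lra).
      rewrite Rabs_left by lra. lra.
Qed.

(** * Continuity with respect to the Euclidean topology *)

Definition tau_continuous s (h : R -> R) : Prop :=
  forall U x, tau s U -> U (h x) -> exists d, 0 < d /\ forall y, Rabs (y - x) < d -> U (h y).

(* Near a point the curve [h] stays in an open set W as in [tau_gaps]; the gaps of W cut
   it into countably many disjoint closed pieces, so by Sierpinski it stays in one of them.
   This piece is bounded, and on bounded sets [tau s] is the Euclidean topology. *)
Lemma tau_continuous_cont s h : tau_continuous s h -> cont h.
Proof.
  intros Hh x0 eps e0.
  destruct (tau_gaps s (h x0)) as [W [HW [Wx gaps]]].
  destruct (Hh W x0 HW Wx) as [d0 [d0p Hd0]].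
  pose (a := x0 - d0 / 2). pose (b := x0 + d0 / 2).
  assert (Wab : forall y, a <= y <= b -> W (h y)).
  { intros y Hy; apply Hd0, Rabs_def1; unfold a, b in Hy; lra. }
  pose (between := fun p u v : R => u < p < v \/ v < p < u).
  (* Cell n consists of the points that [h] sends into the order component of W around [q n]. *)
  pose (F := fun n y => W (q n) /\ forall p, ~ W p -> ~ between p (h y) (q n)).
  assert (HF : closed_cells a b F).
  { split; [|split].
    - intros n y Hy nF. destruct (classic (W (q n))) as [Wq|Wq].
      2:{ exists 1; split; [lra|]. intros z _ _ [C _]; tauto. }
      assert (B : exists p, ~ W p /\ between p (h y) (q n)).
      { apply NNPP; intros N; apply nF; split; [exact Wq|]. intros p Wp C; apply N; eauto. }
      destruct B as [p [Wp Hp]].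
      (* The gap between [h y] and [q n], with a gap on the other side of [q n], bounds an interval
         that misses [h y]. Its complement is open, so nearby points also stay outside cell n. *)
      assert (B : exists u v, ~ W u /\ ~ W v /\ u < q n < v /\ ~ (u <= h y <= v)).
      { destruct (gaps (q n)) as [[v [qv Wv]] [u [uq Wu]]].
        destruct Hp as [Hp|Hp]; [exists p, v|exists u, p]; repeat split; auto; lra. }
      destruct B as [u [v [Wu [Wv [uqv N]]]]].
      destruct (Hh _ y (tau_outside s u v) N) as [d [dp Hd]].
      exists d; split; [exact dp|]. intros z Hz zy [_ C].
      specialize (Hd z zy); simpl in Hd.
      destruct (Rlt_dec (h z) u) as [L|L].
      + apply (C u Wu); left; lra.
      + apply (C v Wv); right; lra.
    - intros y Hy. destruct (tau_eta s W (h y) HW (Wab y Hy)) as [d [dp Hd]].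
      destruct (q_dense (h y) (h y + d)) as [n Hn]; [lra|].
      exists n; split; [apply Hd, Rabs_def1; lra|].
      intros p Wp [C|C]; [|lra]. apply Wp, Hd, Rabs_def1; lra.
    - intros n m x y Hx Hy [Wn nx] [Wm mx] [_ ny]. split; [exact Wm|].
      intros p Wp. specialize (nx p Wp); specialize (mx p Wp); specialize (ny p Wp).
      assert (p <> h x) by (intros ->; auto). assert (p <> h y) by (intros ->; auto).
      assert (p <> q n) by (intros ->; auto). assert (p <> q m) by (intros ->; auto).
      unfold between in *; lra. }
  assert (x0ab : a <= x0 <= b) by (unfold a, b; lra).
  assert (HF' := HF). destruct HF' as [_ [Fcov _]]. destruct (Fcov x0 x0ab) as [n nx0].
  assert (all : forall y, a <= y <= b -> F n y) by (intros y Hy; apply (Sierpinski a b F HF n x0 y); auto).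
  destruct (gaps (q n)) as [[v [qv Wv]] [u [uq Wu]]].
  assert (box : forall y, a <= y <= b -> u <= h y <= v).
  { intros y Hy. destruct (all y Hy) as [_ C].
    split; apply Rnot_lt_le; intros L; [apply (C u Wu)|apply (C v Wv)]; [left|right]; lra. }
  destruct (large_nat u) as [ju Hu], (large_nat v) as [jv Hv].
  pose (j := (ju + jv)%nat).
  assert (id : forall y, a <= y <= b -> level j false (h y) = h y).
  { intros y Hy; apply level_id. unfold j; rewrite plus_INR. specialize (box y Hy).
    assert (A1 := Rle_abs v). assert (A2 := Rle_abs (- u)). rewrite Rabs_Ropp in A2.
    assert (P1 := pos_INR ju). assert (P2 := pos_INR jv). apply Rabs_le; lra. }
  destruct (Hh (near (family s) (inl (j, false) :: nil) eps (h x0)) x0) as [d [dp Hd]].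
  { apply topo_near. }
  { apply near_refl, e0. }
  exists (Rmin (d0 / 2) d); split; [apply Rmin_pos; lra|].
  intros y Hy. assert (M1 := Rmin_l (d0 / 2) d). assert (M2 := Rmin_r (d0 / 2) d).
  assert (Hyd : Rabs (y - x0) < d) by lra.
  specialize (Hd y Hyd _ (or_introl eq_refl)); simpl in Hd.
  assert (Hy2 : Rabs (y - x0) < d0 / 2) by lra. apply Rabs_def2 in Hy2.
  rewrite !id in Hd by (unfold a, b; lra). exact Hd.
Qed.

(** * Recognising the marks by their neighbourhoods *)

Definition unbounded_below_at s x : Prop :=
  forall U, tau s U -> U x -> forall M, exists y, y < M /\ U y.

(** The integers -(4 i + 2) with i coding (n, N) copy mark n in every trace, and for large N in each
    of the finitely many levels of a basic neighbourhood. *)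
Lemma mark_unbounded_below s n : unbounded_below_at s (mark n).
Proof.
  intros U HU Un M. destruct (HU _ Un) as [l [eps [e0 H]]].
  destruct (level_bound l) as [J HJ].
  pose (N := (Z.to_nat (Z.abs (up M)) + J + 1)%nat).
  assert (T := to_nat_non_decreasing n N). set (i := to_nat (n, N)) in *.
  exists (IZR (- (4 * Z.of_nat i + 2))); split.
  - destruct (archimed M) as [A1 A2].
    assert (B : IZR (- (4 * Z.of_nat i + 2)) < IZR (up M - 1)) by (apply IZR_lt; lia).
    rewrite minus_IZR in B; lra.
  - apply H. intros k Hk.
    replace (family s k (IZR (- (4 * Z.of_nat i + 2)))) with (family s k (mark n)).
    + rewrite Rminus_diag, Rabs_R0; exact e0.
    + unfold mark. destruct k as [[j c]|k]; cbn [family].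
      * rewrite level_src by (apply HJ in Hk; lia). unfold i; rewrite cancel_of_to; reflexivity.
      * rewrite trace_src. unfold i; rewrite cancel_of_to; reflexivity.
Qed.

Lemma mark_gap x : (forall n, x <> mark n) -> exists d, 0 < d /\ forall n, d <= Rabs (mark n - x).
Proof.
  intros Hx. unfold mark in *.
  destruct (Rlt_dec 0 x) as [L|L].
  { exists x; split; [exact L|]. intros n. assert (IZR (- 4 * Z.of_nat n) <= 0) by (apply IZR_le; lia).
    rewrite Rabs_left1; lra. }
  assert (B := Int_part_bounds (x / 4)). set (u := Int_part (x / 4)) in *.
  assert (B' : IZR (4 * u) <= x < IZR (4 * u) + 4) by (rewrite mult_IZR; lra).
  assert (ux : x <> IZR (4 * u)).
  { assert (u0 : (u <= 0)%Z) by (apply le_IZR; lra).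
    specialize (Hx (Z.to_nat (- u))). replace (- 4 * Z.of_nat (Z.to_nat (- u)))%Z with (4 * u)%Z in Hx by lia.
    exact Hx. }
  exists (Rmin (x - IZR (4 * u)) (IZR (4 * u) + 4 - x)); split; [apply Rmin_pos; lra|].
  assert (M1 := Rmin_l (x - IZR (4 * u)) (IZR (4 * u) + 4 - x)).
  assert (M2 := Rmin_r (x - IZR (4 * u)) (IZR (4 * u) + 4 - x)).
  intros n. destruct (Z_le_gt_dec (- 4 * Z.of_nat n) (4 * u)) as [C|C].
  - apply IZR_le in C. rewrite Rabs_left1; lra.
  - assert (C' : (4 * u + 4 <= - 4 * Z.of_nat n)%Z) by lia.
    apply IZR_le in C'. rewrite plus_IZR in C'. rewrite Rabs_pos_eq; lra.
Qed.

Lemma unbounded_below_mark s x : unbounded_below_at s x -> exists n, x = mark n.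
Proof.
  intros H. apply NNPP; intros N.
  destruct (mark_gap x) as [d [d0 Hd]]; [intros n E; apply N; eauto|].
  destruct (large_nat x) as [j Hj]. assert (P := pos_INR j).
  (* At distance t from an even integer copying mark n, the two levels are (1 - t) * mark n and the
     same plus t. Both within eps of x give t < 2 eps; as |mark n| <= j, mark n is then closer to x
     than eps (1 + 2 j) = d. *)
  pose (eps := d / (1 + 2 * INR j)).
  assert (Ee : eps * (1 + 2 * INR j) = d) by (unfold eps; field; lra).
  assert (e0 : 0 < eps) by (unfold eps; apply Rdiv_lt_0_compat; lra).
  destruct (H (near (family s) (inl (j, false) :: inl (j, true) :: nil) eps x)) with (M := - INR j - 2)
    as [y [yM Hy]].
  { apply topo_near. }
  { apply near_refl, e0. }
  assert (Y0 := Hy _ (or_introl eq_refl)).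
  assert (Y1 := Hy _ (or_intror (or_introl eq_refl))). simpl in Y0, Y1.
  rewrite (level_id j false x) in Y0 by exact Hj. rewrite (level_id j true x) in Y1 by exact Hj.
  assert (B := Int_part_bounds y). set (m := Int_part y) in *.
  assert (mj : (m + 1 < - Z.of_nat j)%Z).
  { apply lt_IZR. rewrite plus_IZR, opp_IZR, <- INR_IZR_INZ. lra. }
  rewrite (level_on j false m y) in Y0 by lra. rewrite (level_on j true m y) in Y1 by lra.
  assert (K1 : forall t n, (4 * n <= j)%nat -> 0 <= t <= 1 ->
     Rabs ((1 - t) * mark n - x) < eps -> Rabs ((1 - t) * mark n + t - x) < eps -> False).
  { intros t n Hn Ht Z0 Z1. specialize (Hd n).
    assert (mb : - INR j <= mark n <= 0).
    { unfold mark. rewrite INR_IZR_INZ, <- opp_IZR. split; apply IZR_le; lia. }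
    apply Rabs_def2 in Z0, Z1.
    assert (t < 2 * eps) by lra.
    assert (Rabs (mark n - x) < d); [|lra].
    apply Rabs_def1; nra. }
  pose (t := y - IZR m). fold t in Y0, Y1. assert (Ht : 0 <= t <= 1) by (unfold t; lra).
  destruct (Z.odd m) eqn:Om.
  - assert (Om' : Z.odd (m + 1) = false) by (rewrite Z.odd_add, Om; reflexivity).
    destruct (level_even j (m + 1)) as [n [Hn E]]; [lia|exact Om'|].
    rewrite E, (level_odd j false m) in Y0 by (auto; lia).
    rewrite E, (level_odd j true m) in Y1 by (auto; lia).
    apply (K1 (1 - t) n Hn); [lra| |].
    + replace ((1 - (1 - t)) * mark n - x) with (0 + t * (mark n - 0) - x) by ring; exact Y0.
    + replace ((1 - (1 - t)) * mark n + (1 - t) - x) with (1 + t * (mark n - 1) - x) by ring; exact Y1.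
  - assert (Om' : Z.odd (m + 1) = true) by (rewrite Z.odd_add, Om; reflexivity).
    destruct (level_even j m) as [n [Hn E]]; [lia|exact Om|].
    rewrite E, (level_odd j false (m + 1)) in Y0 by (auto; lia).
    rewrite E, (level_odd j true (m + 1)) in Y1 by (auto; lia).
    apply (K1 t n Hn); [lra| |].
    + replace ((1 - t) * mark n - x) with (mark n + t * (0 - mark n) - x) by ring; exact Y0.
    + replace ((1 - t) * mark n + t - x) with (mark n + t * (1 - mark n) - x) by ring; exact Y1.
Qed.

(** * The filter of 0 on the marks and the weight *)

Lemma tau_at_0 s U : tau s U -> U 0 -> exists (ks : list K) J, forall n, (J <= n)%nat ->
  (forall k, In k ks -> (covers (e k) n <-> s k = true)) -> U (mark n).
Proof.
  intros HU U0. destruct (HU 0 U0) as [l [eps [e0 H]]].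
  destruct (level_bound l) as [J HJ].
  (* The list keeps the traces. The bound S J excludes n = 0 and puts the mark beyond all levels
     involved, which vanish there as at 0. *)
  exists (flat_map (fun i => match i with inl _ => nil | inr k => k :: nil end) l), (S J).
  intros n Hn Hk. apply H. intros i Hi.
  replace (family s i (mark n)) with (family s i 0); [rewrite Rminus_diag, Rabs_R0; exact e0|].
  destruct i as [[j c]|k]; cbn [family]; unfold mark.
  - rewrite level_mark by (apply HJ in Hi; lia). apply level_id. rewrite Rabs_R0; apply pos_INR.
  - rewrite trace_0, trace_in; [reflexivity|]. apply Hk, in_flat_map. exists (inr k); split; [exact Hi|left; reflexivity].
Qed.

(** The radius 1 / 2 separates the values 0 and 1 that a trace takes on the marks. *)
Definition trace_nbhd s k : R -> Prop := near (family s) (inr k :: nil) (1 / 2) 0.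

Lemma trace_nbhd_0 s k : trace_nbhd s k 0.
Proof. apply near_refl; lra. Qed.

Lemma trace_nbhd_mark s k n : (0 < n)%nat -> trace_nbhd s k (mark n) -> (covers (e k) n <-> s k = true).
Proof.
  intros n0 H. apply NNPP; intros N.
  specialize (H _ (or_introl eq_refl)); cbn [family] in H. unfold mark in H.
  rewrite trace_0, trace_out in H; auto. rewrite Rminus_0_r, Rabs_R1 in H. lra.
Qed.

Hypothesis e_inj : forall i j, e i = e j -> i = j.

(** For the lower bound, choose for each k a base member around 0 inside [trace_nbhd s k]. By
    [tau_at_0] one member is governed by finitely many conditions, and by independence these imply
    no further one, so it serves only finitely many k. *)
Lemma tau_weight s : embeds nat K -> weight_eq (tau s) K.
Proof.
  intros Kinf. apply topo_weight; auto.
  - assert (Kinf' := Kinf). destruct Kinf' as [a Ha].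
    apply embeds_trans with (K * K)%type; [|apply embeds_square, Kinf].
    destruct (embeds_square nat) as [p Hp]; [exists (fun n => n); auto|].
    exists (fun i : nat * bool + K => match i with inl (j, c) => (a (S (p (j, if c then 1%nat else 0%nat))), a 0%nat) | inr k => (a 0%nat, k) end).
    intros [[j c]|k] [[j' c']|k'] E; injection E; intros.
    + match goal with H : a _ = a _ |- _ => apply Ha in H; injection H; intros Q end.
      apply Hp in Q. injection Q; intros Q1 Q2. destruct c, c'; try discriminate; subst; reflexivity.
    + match goal with H : a (S _) = a _ |- _ => apply Ha in H; discriminate end.
    + match goal with H : a _ = a (S _) |- _ => apply Ha in H; discriminate end.
    + subst; reflexivity.
  - intros B [B1 B2].
    destruct (functional_choice (fun k (b : {b | B b}) => proj1_sig b 0 /\ subsetR (proj1_sig b) (trace_nbhd s k))) as [f Hf].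
    { intros k. destruct (B2 (trace_nbhd s k) 0) as [b [Bb [b0 bs]]].
      - apply topo_near.
      - apply trace_nbhd_0.
      - exists (exist _ b Bb); auto. }
    apply (embeds_of_finite_fibres K _ f Kinf). intros b.
    destruct (classic (proj1_sig b 0)) as [b0|b0].
    2:{ exists nil; intros k E; subst b; apply b0, Hf. }
    destruct (tau_at_0 s (proj1_sig b)) as [ks [J HJ]]; [apply B1, proj2_sig|exact b0|].
    exists ks; intros k E. apply NNPP; intros N.
    (* Flipping [s] at k alone yields a mark that satisfies the conditions in [ks] and violates the
       one for k. *)
    pose (s' := fun k' => if excluded_middle_informative (k' = k) then negb (s k) else s k').
    destruct (covers_independent_family K e e_inj s' (k :: ks) (S J)) as [n [Jn Hn]].
    assert (C : covers (e k) n <-> s k = true).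
    { apply trace_nbhd_mark; [lia|]. apply (proj2 (Hf k)). rewrite E. apply HJ; [lia|].
      intros k' Hk'. rewrite (Hn k') by (right; exact Hk'). unfold s'.
      destruct (excluded_middle_informative (k' = k)); [subst; tauto|tauto]. }
    rewrite (Hn k) in C by (left; reflexivity). unfold s' in C.
    destruct (excluded_middle_informative (k = k)); [|tauto].
    destruct (s k); simpl in C; intuition discriminate.
Qed.

(** * Rigidity of homeomorphisms *)

Lemma homeomorphism_fixes_marks s t h g :
  (forall x, g (h x) = x) -> (forall y, h (g y) = y) ->
  (forall U, tau t U -> tau s (fun x => U (h x))) ->
  (forall U, tau s U -> tau t (fun y => U (g y))) ->
  forall n, h (mark n) = mark n.
Proof.
  intros gh hg Hh Hg.
  assert (mono : (forall x y, x < y -> h x < h y) \/ (forall x y, x < y -> h y < h x)).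
  { apply cont_injective_monotone.
    - apply (tau_continuous_cont t). intros U x HU Ux. apply (tau_eta s (fun x => U (h x))); auto.
    - intros x y E. rewrite <- (gh x), <- (gh y), E; reflexivity. }
  destruct mono as [inc|dec].
  - assert (incg : forall x y, x < y -> g x < g y).
    { intros x y xy. apply Rnot_le_lt; intros [C|C].
      - apply inc in C. rewrite !hg in C; lra.
      - apply (f_equal h) in C. rewrite !hg in C; lra. }
    assert (mh : forall n, exists n', h (mark n) = mark n').
    { intros n. apply (unbounded_below_mark t). intros U HU Un M.
      destruct (mark_unbounded_below s n (fun x => U (h x)) (Hh U HU) Un (g M)) as [y [yM Uy]].
      exists (h y); split; [|exact Uy]. apply inc in yM. rewrite hg in yM; exact yM. }
    assert (mg : forall n, exists n', g (mark n) = mark n').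
    { intros n. apply (unbounded_below_mark s). intros U HU Un M.
      destruct (mark_unbounded_below t n (fun x => U (g x)) (Hg U HU) Un (h M)) as [y [yM Uy]].
      exists (g y); split; [|exact Uy]. apply incg in yM. rewrite gh in yM; exact yM. }
    assert (lt_mark : forall n m, mark n < mark m -> (m < n)%nat).
    { intros n m H. apply lt_IZR in H. lia. }
    assert (mark_lt : forall n m, (m < n)%nat -> mark n < mark m) by (intros n m H; apply IZR_lt; lia).
    (* Marks decrease with their index, and an increasing map sending marks to marks cannot lower an
       index. Applied to both [h] and [g], this forces equality. *)
    assert (down : forall k : R -> R, (forall x y, x < y -> k x < k y) ->
        (forall n, exists n', k (mark n) = mark n') -> forall n, k (mark n) <= mark n).
    { intros k kinc km n. destruct (km n) as [m Hm].
      assert (L : (n <= m)%nat); [|rewrite Hm; apply IZR_le; lia].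
      revert m Hm; induction n as [|n IH]; intros m Hm; [lia|].
      destruct (km n) as [m' Hm']. specialize (IH m' Hm').
      assert (m' < m)%nat; [|lia]. apply lt_mark. rewrite <- Hm, <- Hm'. apply kinc, mark_lt; lia. }
    intros n. apply Rle_antisym; [apply down; auto|].
    assert (G := down g incg mg n). destruct G as [G|G].
    + apply inc in G. rewrite hg in G; lra.
    + rewrite <- G at 2. rewrite hg; lra.
  (* A decreasing [h] would turn unboundedness above at [g 1] into unboundedness below at 1, which
     is not a mark. *)
  - exfalso. destruct (unbounded_below_mark t 1) as [n Hn].
    + intros U HU U1 M. rewrite <- (hg 1) in U1.
      destruct (tau_unbounded_above s (fun x => U (h x)) (g 1) (g M) (Hh U HU) U1) as [y [yM Uy]].
      exists (h y); split; [|exact Uy]. apply dec in yM. rewrite hg in yM; exact yM.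
    + apply eq_IZR in Hn. lia.
Qed.

(** Let s and t differ at k. The preimage of [trace_nbhd t k] is a neighbourhood of 0 in [tau s], so
    by independence it contains a mark whose index obeys the condition for [s k]. As [h] fixes this
    mark, the index also obeys the condition for [t k]. *)
Lemma tau_not_homeomorphic s t : s <> t -> ~ homeomorphic (tau s) (tau t).
Proof.
  intros st [h [g [gh [hg [Hh Hg]]]]].
  assert (fix_mark := homeomorphism_fixes_marks s t h g gh hg Hh Hg).
  assert (D : exists k, s k <> t k).
  { apply NNPP; intros N. apply st, FunctionalExtensionality.functional_extensionality.
    intros k; apply NNPP; intros C; apply N; eauto. }
  destruct D as [k Hk].
  destruct (tau_at_0 s (fun x => trace_nbhd t k (h x))) as [ks [J HJ]].
  - apply Hh, topo_near.
  - change 0 with (mark 0). rewrite fix_mark. apply trace_nbhd_0.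
  - destruct (covers_independent_family K e e_inj s (k :: ks) (S J)) as [n [Jn Hn]].
    assert (C : covers (e k) n <-> t k = true).
    { apply trace_nbhd_mark; [lia|]. rewrite <- fix_mark. apply HJ; [lia|].
      intros k' Hk'; apply Hn; right; exact Hk'. }
    rewrite (Hn k) in C by (left; reflexivity).
    apply Hk. destruct (s k), (t k); intuition congruence.
Qed.

End Topologies.

(* kappa is represented by a type K: infinite (nat injects into K) and
   kappa <= c (K injects into R).  2^kappa is the type K -> bool. *)
Theorem theorem11 (K : Type)
  (Kinf : exists e : nat -> K, forall m n, e m = e n -> m = n)
  (Kle : exists e : K -> R, forall i j, e i = e j -> i = j) :
  exists T : (K -> bool) -> ((R -> Prop) -> Prop),
    (forall s, in_L (T s) /\ completely_normal (T s) /\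
               first_category (T s) /\ weight_eq (T s) K) /\
    (forall s t, s <> t -> ~ homeomorphic (T s) (T t)).
Proof.
  destruct Kle as [e e_inj]. exists (tau e); split.
  - intros s; split; [|split; [|split]].
    + apply topo_in_L; [apply family_cont|apply family_sep].
    + apply topo_completely_normal; [apply family_cont|apply family_sep].
    + apply tau_first_category.
    + apply tau_weight; assumption.
  - apply tau_not_homeomorphic, e_inj.
Qed.
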